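(* Let $G\le \mathrm{Aut}~T_4$ be the GGS-group given by a defining vector $\mathbf{e}=(e_1,e_2,e_3)\in(\mathbb{Z}/4\mathbb{Z})^3$ which is not invertible-symmetric. Then the closure $\overline{G}$ of $G$ satisfies $$\mathrm{hdim}_{W_4}(\overline{G})=\begin{cases} 3/4,&\text{if } e_1+e_2+e_3\equiv 1 \bmod 2,\\ 9/16,&\text{otherwise}. \end{cases}$$ What is more, the logarithmic orders of the congruence quotients $G_n=G/\mathrm{St}_G(n)$ are $$\log|G_n|=\begin{cases} 4^{n-1}+1 \ \text{ for all } n\ge 1,&\text{if } e_1+e_2+e_3\equiv 1\bmod 2,\\ 3\cdot 4^{n-2}+1 \ \text{ for all } n\ge 2,&\text{otherwise}. \end{cases}$$
   Context: All logarithms are in base $4$. Tree and automorphisms: $T_4$ is the rooted tree in which each vertex has exactly $4$ immediate descendants, identified with the free monoid on $\{1,2,3,4\}$; the $n$th level is the set of vertices at distance $n$ from the root. $\mathrm{Aut}~T_4$ is its group of graph automorphisms (acting on the right). For $f\in \mathrm{Aut}~T_4$ and a vertex $v$, the section $f|_v\in\mathrm{Aut}~T_4$ is the unique automorphism with $(vu)^f=v^fu^{f|_v}$ for every $u\in T_4$. There is an isomorphism $\psi:\mathrm{Aut}~T_4\to (\mathrm{Aut}~T_4)^4\rtimes \mathrm{Sym}(4)$, $f\mapsto (f|_1,f|_2,f|_3,f|_4)\sigma_f$, where $\sigma_f$ is the permutation action of $f$ on the first level. For $G\le\mathrm{Aut}~T_4$, $\mathrm{St}_G(n)$ is the pointwise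 stabilizer in $G$ of the $n$th level. GGS-groups: for $\mathbf{e}=(e_1,e_2,e_3)\in(\mathbb{Z}/4\mathbb{Z})^3$, the GGS-group acting on $T_4$ with defining vector $\mathbf{e}$ is the group $G=\langle a,b\rangle\le \mathrm{Aut}~T_4$, where $a$ is given by $\psi(a)=(1,1,1,1)(1\,2\,3\,4)$ and $b$ is defined recursively by $\psi(b)=(a^{e_1},a^{e_2},a^{e_3},b)$. The vector $\mathbf{e}$ is called invertible-symmetric if, for every $1\le i\le 3$, $e_i$ is a unit modulo $4$ if and only if $e_{4-i}$ is a unit modulo $4$. Hausdorff dimension: $W_4\le\mathrm{Aut}~T_4$ is the closed subgroup of all automorphisms $f$ whose local action $\sigma_{f|_v}$ at every vertex $v$ lies in $\langle(1\,2\,3\,4)\rangle$; all the GGS-groups above are subgroups of $W_4$. Closures are taken in the congruence topology, in which the pointwise stabilizers of the levels form a base of open neighbourhoods of the identity. For a closed subgroup $G\le W_4$, $$\mathrm{hdim}_{W_4}(G)=\liminf_{n\to\infty}\frac{\log|G:\mathrm{St}_G(n)|}{\log|W_4:\mathrm{St}_{W_4}(n)|}.$$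
   Formalization: When e_1+e_2+e_3 is odd, the formula log|G_n| = 4^{n-1}+1 is stated for n ≥ 2 rather than n ≥ 1: at n = 1 it fails, since b fixes the first level and a acts as a 4-cycle, so |G_1| = 4 and log|G_1| = 1, not 2. *)

(* Defs.v *)
From HB Require Import structures.
From mathcomp Require Import all_boot all_order all_algebra all_fingroup.
From mathcomp Require Import finmap.
From mathcomp Require Import all_classical all_reals all_analysis.
Set Implicit Arguments.
Unset Strict Implicit.
Unset Printing Implicit Defensive.
Import Order.TTheory GRing.Theory Num.Theory.
Local Open Scope classical_set_scope.

Section Groups.
Variable gT : groupType.
Local Open Scope group_scope.

Definition is_subgroup (H : set gT) : Prop :=
  [/\ H 1, forall x y, H x -> H y -> H (x * y) & forall x, H x -> H x^-1].

Definition generated (S : set gT) : set gT := smallest is_subgroup S.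

Definition right_cosets (G H : set gT) : set (set gT) :=
  [set [set h * g | h in H] | g in G].

(* The index |G : H|; as #|` fset_set _| is 0 on infinite sets, the value is 0
   when the index is infinite. *)
Definition group_index (G H : set gT) : nat :=
  #|` fset_set (right_cosets G H)|%fset.

End Groups.

(* The letters 1, 2, 3, 4 are the elements 0, 1, 2, 3 of 'I_4. *)
Definition letter := 'I_4.
Definition vertex := seq letter.

Definition child (u v : vertex) : bool := [exists x : letter, v == rcons u x].
Definition adjacent (u v : vertex) : bool := child u v || child v u.

Record tree_aut := TreeAut {
  taut :> vertex -> vertex;
  taut_bij : bijective taut;
  taut_adj : forall u v, adjacent (taut u) (taut v) = adjacent u v }.

HB.instance Definition _ := gen_eqMixin tree_aut.
HB.instance Definition _ := gen_choiceMixin tree_aut.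

Lemma tree_autP (f g : tree_aut) : f =1 g -> f = g.
Proof.
case: f g => [f fb fa] [g gb ga] /= fg.
have E : f = g by apply/funext.
by subst g; congr TreeAut; exact: Prop_irrelevance.
Qed.

Lemma tree_aut_one_adj u v :
  adjacent (@id vertex u) (@id vertex v) = adjacent u v.
Proof. by []. Qed.

Definition tree_aut_one := TreeAut (Bijective (fun _ => erefl) (fun _ => erefl))
  tree_aut_one_adj.

Lemma tree_aut_mul_adj (f g : tree_aut) u v :
  adjacent ((g \o f) u) ((g \o f) v) = adjacent u v.
Proof. by rewrite /= !taut_adj. Qed.

(* Automorphisms act on the right, so in the product f * g the factor f is
   applied first. *)
Definition tree_aut_mul (f g : tree_aut) :=
  TreeAut (bij_comp (taut_bij g) (taut_bij f)) (@tree_aut_mul_adj f g).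

Lemma taut_inv_exists (f : tree_aut) :
  exists g : vertex -> vertex, cancel f g /\ cancel g f.
Proof. by case: (taut_bij f) => g fK gK; exists g. Qed.

Definition taut_inv (f : tree_aut) : vertex -> vertex :=
  sval (cid (taut_inv_exists f)).

Lemma tautK (f : tree_aut) : cancel f (taut_inv f).
Proof. by rewrite /taut_inv; case: (cid _) => g []. Qed.

Lemma taut_invK (f : tree_aut) : cancel (taut_inv f) f.
Proof. by rewrite /taut_inv; case: (cid _) => g []. Qed.

Lemma taut_inv_adj (f : tree_aut) u v :
  adjacent (taut_inv f u) (taut_inv f v) = adjacent u v.
Proof. by rewrite -(taut_adj f) !taut_invK. Qed.

Definition tree_aut_inv (f : tree_aut) :=
  TreeAut (Bijective (taut_invK f) (tautK f)) (@taut_inv_adj f).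

Lemma tree_aut_mulA : associative tree_aut_mul.
Proof. by move=> f g h; apply: tree_autP. Qed.
Lemma tree_aut_mul1g : left_id tree_aut_one tree_aut_mul.
Proof. by move=> f; apply: tree_autP. Qed.
Lemma tree_aut_mulg1 : right_id tree_aut_one tree_aut_mul.
Proof. by move=> f; apply: tree_autP. Qed.
Lemma tree_aut_mulVg : left_inverse tree_aut_one tree_aut_inv tree_aut_mul.
Proof. by move=> f; apply: tree_autP => u /=; rewrite taut_invK. Qed.
Lemma tree_aut_mulgV : right_inverse tree_aut_one tree_aut_inv tree_aut_mul.
Proof. by move=> f; apply: tree_autP => u /=; rewrite tautK. Qed.

HB.instance Definition _ := isGroup.Build tree_aut
  tree_aut_mulA tree_aut_mul1g tree_aut_mulg1 tree_aut_mulVg tree_aut_mulgV.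

Lemma taut1E u : (1%g : tree_aut) u = u. Proof. by []. Qed.
Lemma tautME (f g : tree_aut) u : (f * g)%g u = g (f u). Proof. by []. Qed.

Lemma tautKg (f : tree_aut) : cancel f (f^-1)%g. Proof. exact: tautK. Qed.
Lemma tautVKg (f : tree_aut) : cancel (f^-1)%g f. Proof. exact: taut_invK. Qed.

(* The root is the only vertex of degree 4, so it is fixed. *)
Lemma childP u v : reflect (exists x, v = rcons u x) (child u v).
Proof. by apply: (iffP existsP) => -[x]; [move/eqP|move=> ->]; exists x. Qed.

Lemma child_rcons u x : child u (rcons u x).
Proof. by apply/childP; exists x. Qed.

Lemma taut_root (f : tree_aut) : f [::] = [::].
Proof.
case/lastP E: (f [::]) => [//|p y].
pose nb (o : option letter) : vertex :=
  if o is Some i then rcons (rcons p y) i else p.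
have nbI : injective nb.
  move=> [i|] [j|] //=.
  - by move=> /rcons_inj [->].
  - by move=> /(congr1 size); rewrite !size_rcons => /eqP; rewrite gtn_eqF.
  - by move=> /(congr1 size); rewrite !size_rcons => /eqP; rewrite ltn_eqF.
have nbE o : exists i, taut_inv f (nb o) = [:: i].
  have : adjacent [::] (taut_inv f (nb o)).
    rewrite -(taut_adj f) taut_invK E /adjacent.
    by case: o => [i|] /=; rewrite child_rcons ?orbT.
  case/orP => /childP [i]; last by case: (taut_inv _ _).
  by move=> ->; exists i.
pose h o := sval (cid (nbE o)).
have hE o : taut_inv f (nb o) = [:: h o] by rewrite /h; case: (cid _).
have hI : injective h.
  move=> o o' hh; apply: nbI; apply: (can_inj (taut_invK f)).
  by rewrite !hE hh.
by have := leq_card h hI; rewrite card_option !card_ord.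
Qed.

Lemma taut_child (f : tree_aut) u x :
  exists y, f (rcons u x) = rcons (f u) y.
Proof.
elim/last_ind: u x => [|p z IH] x.
  have : adjacent (f [::]) (f [:: x]) by rewrite taut_adj /adjacent child_rcons.
  rewrite taut_root => /orP [] /childP [y]; first by move=> ->; exists y.
  by case: (f _).
have : adjacent (f (rcons p z)) (f (rcons (rcons p z) x)).
  by rewrite taut_adj /adjacent child_rcons.
case/orP => /childP [y Ey]; first by exists y.
have [t Et] := IH z; move: Ey; rewrite Et => /rcons_inj [Ep _].
have /(congr1 size) := bij_inj (taut_bij f) Ep.
by rewrite !size_rcons => /eqP; rewrite ltn_eqF // ltnS leqnSn.
Qed.

Lemma size_taut (f : tree_aut) u : size (f u) = size u.
Proof.
elim/last_ind: u => [|u x IH]; first by rewrite taut_root.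
by have [y ->] := taut_child f u x; rewrite !size_rcons IH.
Qed.

Definition section_fun (f : tree_aut) (v u : vertex) : vertex :=
  drop (size v) (f (v ++ u)).

Lemma section_funE (f : tree_aut) v u :
  f (v ++ u) = f v ++ section_fun f v u.
Proof.
rewrite /section_fun.
elim/last_ind: u => [|u x IH].
  by rewrite cats0 drop_oversize ?size_taut // cats0.
rewrite -rcons_cat; have [y ->] := taut_child f (v ++ u) x.
rewrite {1}IH rcons_cat; congr (_ ++ _).
by rewrite drop_rcons // size_taut size_cat leq_addr.
Qed.

Lemma section_fun_bij f v : bijective (section_fun f v).
Proof.
exists (section_fun (f^-1)%g (f v)) => u; rewrite /section_fun.
- have := section_funE f v u; rewrite /section_fun => <-.
  by rewrite tautKg size_taut drop_size_cat.
- have := section_funE (f^-1)%g (f v) u; rewrite /section_fun tautKg => <-.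
  by rewrite tautVKg -(size_taut f v) drop_size_cat.
Qed.

Lemma child_catl v u w : child (v ++ u) (v ++ w) = child u w.
Proof.
apply/childP/childP => -[x E]; exists x; last by rewrite E rcons_cat.
by move/eqP: E; rewrite rcons_cat eqseq_cat // eqxx => /eqP.
Qed.

Lemma adjacent_catl v u w : adjacent (v ++ u) (v ++ w) = adjacent u w.
Proof. by rewrite /adjacent !child_catl. Qed.

Lemma section_fun_adj f v u w :
  adjacent (section_fun f v u) (section_fun f v w) = adjacent u w.
Proof.
by rewrite -(adjacent_catl (f v)) -!section_funE taut_adj adjacent_catl.
Qed.

Definition section (f : tree_aut) (v : vertex) : tree_aut :=
  TreeAut (section_fun_bij f v) (@section_fun_adj f v).

Lemma sectionE (f : tree_aut) v u : f (v ++ u) = f v ++ section f v u.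
Proof. exact: section_funE. Qed.

Definition sigma_fun (f : tree_aut) (x : letter) : letter := last x (f [:: x]).

Lemma sigma_funE (f : tree_aut) x : f [:: x] = [:: sigma_fun f x].
Proof.
by rewrite /sigma_fun; have [y] := taut_child f [::] x; rewrite taut_root => ->.
Qed.

Lemma sigma_fun_inj f : injective (sigma_fun f).
Proof.
move=> x y exy; have : f [:: x] = f [:: y] by rewrite !sigma_funE exy.
by move=> /(bij_inj (taut_bij f)) [].
Qed.

Definition sigma (f : tree_aut) : {perm letter} := perm (@sigma_fun_inj f).

Lemma sigmaE (f : tree_aut) x u : f (x :: u) = sigma f x :: section f [:: x] u.
Proof. by rewrite -cat1s sectionE sigma_funE permE. Qed.

Definition level_stab (n : nat) : set tree_aut :=
  [set f | forall v, size v = n -> f v = v].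

Definition stab (G : set tree_aut) (n : nat) : set tree_aut :=
  G `&` level_stab n.

Lemma level_stab_group n : is_subgroup (level_stab n).
Proof.
split=> [v _ //|f g fP gP v sv|f fP v sv]; first by rewrite tautME fP ?gP.
by rewrite -{1}(fP v sv) tautKg.
Qed.

Lemma level_stab_le m n : (m <= n)%N -> level_stab n `<=` level_stab m.
Proof.
move=> mn f fP v sv.
have := fP (v ++ nseq (n - m) ord0); rewrite size_cat size_nseq sv subnKC //.
move=> /(_ erefl); rewrite sectionE => /eqP.
by rewrite eqseq_cat ?size_taut // => /andP [/eqP].
Qed.

Definition congruence_nbhs (f : tree_aut) : set_system tree_aut :=
  filter_from setT (fun n => [set (f * s)%g | s in level_stab n]).

HB.instance Definition _ := hasNbhs.Build tree_aut congruence_nbhs.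

Lemma congruence_nbhs_filter (f : tree_aut) : ProperFilter (nbhs f).
Proof.
apply: filter_from_proper; last first.
  by move=> n _; exists (f * 1)%g; exists 1%g.
apply: filter_from_filter; first by exists 0.
move=> m n _ _; exists (maxn m n) => // _ [s sP <-].
by split; exists s => //; apply: level_stab_le sP; rewrite (leq_maxl, leq_maxr).
Qed.

Lemma congruence_nbhs_singleton (f : tree_aut) (A : set tree_aut) :
  nbhs f A -> A f.
Proof.
by move=> [n _ +]; apply; exists 1%g; rewrite ?mulg1.
Qed.

Lemma congruence_nbhs_nbhs (f : tree_aut) (A : set tree_aut) :
  nbhs f A -> nbhs f (nbhs^~ A).
Proof.
move=> [n _ fA]; exists n => // _ [s sP <-]; exists n => // _ [t tP <-].
apply: fA; exists (s * t)%g; last by rewrite mulgA.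
by have [_ + _] := level_stab_group n; apply.
Qed.

HB.instance Definition _ := Nbhs_isNbhsTopological.Build tree_aut
  congruence_nbhs_filter congruence_nbhs_singleton congruence_nbhs_nbhs.

Lemma tree_aut_of_subproof (f g : vertex -> vertex) : cancel f g -> cancel g f ->
  {homo f : u v / child u v} -> {homo g : u v / child u v} ->
  forall u v, adjacent (f u) (f v) = adjacent u v.
Proof.
move=> fK gK fH gH u v.
have E u' v' : child (f u') (f v') = child u' v'.
  by apply/idP/idP => [/gH|/fH]; rewrite ?fK.
by rewrite /adjacent !E.
Qed.

Definition tree_aut_of (f g : vertex -> vertex) fK gK fH gH : tree_aut :=
  TreeAut (Bijective fK gK) (@tree_aut_of_subproof f g fK gK fH gH).

Lemma taut_homo (f : tree_aut) : {homo f : u v / child u v}.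
Proof.
move=> u v /childP [x ->]; apply/childP; have [y ->] := taut_child f u x.
by exists y.
Qed.

(* 1 |-> 2 |-> 3 |-> 4 |-> 1 *)
Definition cycle4 : {perm letter} := perm (@ordS_inj 4).

Section Rooted.
Variable p : {perm letter}.

Definition rooted_fun (q : {perm letter}) (u : vertex) : vertex :=
  if u is x :: u' then q x :: u' else [::].

Lemma rooted_funK q : cancel (rooted_fun q) (rooted_fun q^-1%g).
Proof. by case=> //= x u; rewrite permK. Qed.

Lemma rooted_funVK q : cancel (rooted_fun q^-1%g) (rooted_fun q).
Proof. by case=> //= x u; rewrite permKV. Qed.

Lemma rooted_fun_homo q : {homo rooted_fun q : u v / child u v}.
Proof.
move=> u v /childP [x ->]; apply/childP.
by case: u => [|y u] /=; [exists (q x) | exists x].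
Qed.

Definition rooted : tree_aut :=
  tree_aut_of (rooted_funK p) (@rooted_funVK p)
    (@rooted_fun_homo p) (@rooted_fun_homo p^-1%g).

End Rooted.

Definition ggs_a : tree_aut := rooted cycle4.

(* [unlift ord_max x] is [Some i] when x is one of the first three letters, i
   being its index, and [None] when x is the letter 4. *)
Fixpoint ggs_b_fun (h : 'I_3 -> tree_aut) (u : vertex) : vertex :=
  if u is x :: u' then
    x :: (if unlift (ord_max : letter) x is Some i then h i u'
          else ggs_b_fun h u')
  else [::].

Lemma ggs_b_funK h : cancel (ggs_b_fun h) (ggs_b_fun (fun i => (h i)^-1%g)).
Proof.
by elim=> //= x u IH; case: (unlift _ x) => [i|]; rewrite ?tautK ?IH.
Qed.

Lemma ggs_b_funVK h : cancel (ggs_b_fun (fun i => (h i)^-1%g)) (ggs_b_fun h).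
Proof.
by elim=> //= x u IH; case: (unlift _ x) => [i|]; rewrite ?taut_invK ?IH.
Qed.

Lemma child_cons x u v : child u v -> child (x :: u) (x :: v).
Proof. by rewrite -(child_catl [:: x]). Qed.

Lemma ggs_b_fun_homo h : {homo ggs_b_fun h : u v / child u v}.
Proof.
elim=> [|x u IH] v /childP [y ->] /=.
  apply/childP; exists y; case: (unlift _ y) => [i|//].
  by rewrite taut_root.
apply: child_cons; case: (unlift _ x) => [i|].
  exact: taut_homo (child_rcons _ _).
exact: IH (child_rcons _ _).
Qed.

Section GGS.
Variable e : 'rV['Z_4]_3.

(* The exponent e_i is taken as its representative in {0, 1, 2, 3}, which is
   harmless since a has order 4. *)
Definition ggs_sec (i : 'I_3) : tree_aut := (ggs_a ^+ (e 0%R i : nat))%g.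

Definition ggs_b : tree_aut :=
  tree_aut_of (ggs_b_funK ggs_sec) (@ggs_b_funVK ggs_sec)
    (@ggs_b_fun_homo ggs_sec) (@ggs_b_fun_homo (fun i => (ggs_sec i)^-1%g)).

Definition GGS : set tree_aut := generated [set ggs_a; ggs_b].

(* psi(a) = (1, 1, 1, 1)(1 2 3 4) and psi(b) = (a^e1, a^e2, a^e3, b) *)
Lemma sigma_ggs_a : sigma ggs_a = cycle4.
Proof. by apply/permP => x; rewrite [LHS]permE /sigma_fun. Qed.

Lemma section_ggs_a x : section ggs_a [:: x] = 1%g.
Proof. by apply: tree_autP => u; rewrite /= /section_fun /= drop0. Qed.

Lemma sigma_ggs_b : sigma ggs_b = 1%g.
Proof.
apply/permP => x; rewrite permE perm1 /sigma_fun /=.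
by case: (unlift _ x) => [i|//]; rewrite taut_root.
Qed.

Lemma section_ggs_b_lift i :
  section ggs_b [:: lift (ord_max : letter) i] = (ggs_a ^+ (e 0%R i : nat))%g.
Proof. by apply: tree_autP => u; rewrite /= /section_fun /= liftK drop0. Qed.

Lemma section_ggs_b_max : section ggs_b [:: (ord_max : letter)] = ggs_b.
Proof. by apply: tree_autP => u; rewrite /= /section_fun /= unlift_none drop0. Qed.

(* With 0-based indices, i |-> 4 - i becomes rev_ord : i |-> 2 - i. *)
Definition invertible_symmetric : Prop :=
  forall i : 'I_3,
    (e 0%R i \is a GRing.unit) = (e 0%R (rev_ord i) \is a GRing.unit).

Definition odd_exponent_sum : bool :=
  ((\sum_(i < 3) (e 0%R i : nat))%N == 1 %[mod 2])%N.

End GGS.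

Definition W4 : set tree_aut :=
  [set f | forall v : vertex, sigma (section f v) \in <[cycle4]>%g].

Section Hausdorff.
Variable R : realType.
Local Open Scope ring_scope.

Definition log4 (x : R) : R := ln x / ln 4.

(* |G_n|, where G_n = G / St_G(n) *)
Definition congruence_quotient_order (G : set tree_aut) (n : nat) : nat :=
  group_index G (stab G n).

(* The term of index n = 0 is 0 / 0 = 0; it does not affect the lower limit. *)
Definition hdim_W4 (G : set tree_aut) : \bar R :=
  limn_einf (fun n : nat =>
    (log4 (congruence_quotient_order G n)%:R /
     log4 (congruence_quotient_order W4 n)%:R)%:E).

End Hausdorff.

(* Main.v *)
Require Import Defs.
From mathcomp Require Import all_boot all_order all_algebra all_fingroup.
From mathcomp Require Import finmap ring.
From mathcomp Require Import all_classical all_reals all_analysis.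
Set Implicit Arguments.
Unset Strict Implicit.
Unset Printing Implicit Defensive.
Import Order.TTheory GRing.Theory Num.Theory numFieldNormedType.Exports.

(** Each element g of G has two exponents modulo 4, which count the
    generators a and b in a word for g. The exponent of a, rexp g, is the
    action on the first level. The exponent of b, beta g, can be read off the
    second level: since the defining vector is not invertible-symmetric, some
    linear form takes the value 1 on all its cyclic shifts (weight_shift).
    Therefore the common kernel of the two exponents, which is the derived
    subgroup K of G, has index 16 in every congruence quotient from the second
    level on.

    The main point is that G is branch over K: elements of K can be prescribed
    freely as sections at the four letters (ristP). Exactly one of the two
    outer entries of the defining vector is odd, and b and its shift b ^ a
    both have powers of a as sections at two of the letters. So the commutator
    of a power of b and a power of b ^ a has at most two nontrivial sections,
    each of which is a commutator of a power of a and a power of b. Playing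
    such commutators off against each other (commute_rist_bootstrap) yields
    [a, b] at a single letter, and hence all of K.

    It follows that an automorphism that fixes the first level lies in G if
    and only if its sections lie in G and their exponents of a are the values
    of a fixed circulant matrix on their exponents of b (GGS_balanced,
    GGS_from_sections). Counting gives |G_(n+1)| = 4 (4 |K_n|)^4 and
    |G_n| = 16 |K_n| for n >= 2, where K_n is the image of K in G_n, so
    |G_n| = 4^(t + 1) implies |G_(n+1)| = 4^(4 t + 1).

    The second level, where the recursion starts, depends on the parity of the
    exponent sum. The vectors of exponents of a in the sections of elements of
    G form the ideal of Z/4[X]/(X^4 - 1) generated by the defining vector. For
    an odd sum this vector is a unit, and the ideal has 4^4 elements; for an
    even sum it is a unit times X - 1 or X + 1, and the ideal has 4^3
    elements. Hence |G_2| is 4^5 or 4^4.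

    Finally W4 is an iterated wreath product, the base 4 logarithm of the
    order of its n-th congruence quotient is (4^n - 1) / 3, and passing to the
    closure of G does not change the congruence quotients, so the dimension is
    an ordinary limit. *)

Local Open Scope ring_scope.

(** * Arithmetic of the defining vector *)

Lemma Z4_ind (P : 'Z_4 -> Prop) : P 0 -> P 1 -> P 2 -> P 3 -> forall x, P x.
Proof.
move=> P0 P1 P2 P3 [[|[|[|[|m]]]] lt_m] //.
- by have -> : Ordinal lt_m = 0 :> 'Z_4 by apply: val_inj.
- by have -> : Ordinal lt_m = 1 :> 'Z_4 by apply: val_inj.
- by have -> : Ordinal lt_m = 2 :> 'Z_4 by apply: val_inj.
- by have -> : Ordinal lt_m = 3 :> 'Z_4 by apply: val_inj.
Qed.

Lemma card_Z4 : #|'Z_4| = 4%N.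
Proof. exact: card_ord. Qed.

Lemma Z4_odd (u : 'Z_4) : odd u = (u \is a GRing.unit).
Proof. by elim/Z4_ind: u. Qed.

Lemma Z4_natrE (u : 'Z_4) : (u : nat)%:R = u.
Proof. exact: natr_Zp. Qed.

Lemma natr_mod4 m : m%:R = 0 :> 'Z_4 -> (4 %| m)%N.
Proof. by move/(congr1 val); rewrite /= val_Zp_nat // => /eqP. Qed.

Lemma sumZ4 (V : nmodType) (F : 'Z_4 -> V) :
  \sum_x F x = F 0 + F 1 + F 2 + F 3.
Proof.
rewrite !big_ord_recl big_ord0 addr0 !addrA.
do ! congr (_ + _); congr (F _); exact: val_inj.
Qed.

Lemma sumZ4_shift (V : nmodType) (F : 'Z_4 -> V) t :
  \sum_x F (x + t) = \sum_x F x.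
Proof. by rewrite [RHS](reindex_inj (addIr t)). Qed.

Section DefiningVector.
Variable e : 'rV['Z_4]_3.

(** The defining vector padded with a zero at the letter 4, where the section
    of b is b itself, which acts trivially on the first level. Indexing by
    'Z_4 lets the vector be read as the element
    ev 0 + ev 1 X + ev 2 X^2 of Z/4[X]/(X^4 - 1). *)
Definition ev (x : 'Z_4) : 'Z_4 :=
  if unlift (ord_max : letter) x is Some i then e 0 i else 0.

Lemma ev_lift (i : 'I_3) : ev (lift (ord_max : letter) i) = e 0 i.
Proof. by rewrite /ev liftK. Qed.

Lemma ev_entries : [/\ ev 0 = e 0 0, ev 1 = e 0 1 & ev 2 = e 0 2].
Proof. split; rewrite -ev_lift; congr ev; exact: val_inj. Qed.

Lemma ev3 : ev 3 = 0.
Proof. by rewrite /ev (_ : 3 = ord_max) ?unlift_none //; apply: val_inj. Qed.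

Lemma ev_cases : ev = fun y =>
  if y == 0 then ev 0 else if y == 1 then ev 1 else if y == 2 then ev 2 else 0.
Proof. by apply/funext; elim/Z4_ind; rewrite //= ev3. Qed.

(** The middle entry is its own mirror image, so only the two outer entries
    can break the symmetry. *)
Lemma unit_asym : ~ invertible_symmetric e ->
  (ev 0 \is a GRing.unit) = ~~ (ev 2 \is a GRing.unit).
Proof.
move=> he.
case E: ((ev 0 \is a GRing.unit) == (ev 2 \is a GRing.unit)); last first.
  by move: E; case: (_ \is a _); case: (_ \is a _).
case: he => i; move/eqP: E.
have [E0 _ E2] := ev_entries; rewrite E0 E2 => E.
case: i => [[|[|[|m]]] lt_m] //.
- have -> : Ordinal lt_m = 0 by apply: val_inj.
  have -> : rev_ord (0 : 'I_3) = 2 by apply: val_inj.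
  by rewrite E.
- by congr (e _ _ \is a _); apply: val_inj.
- have -> : Ordinal lt_m = 2 by apply: val_inj.
  have -> : rev_ord (2 : 'I_3) = 0 by apply: val_inj.
  by rewrite E.
Qed.

Lemma odd_sumE : odd_exponent_sum e = (ev 0 + ev 1 + ev 2 \is a GRing.unit).
Proof.
have [-> -> ->] := ev_entries.
rewrite /odd_exponent_sum !big_ord_recl big_ord0.
have -> : lift ord0 (ord0 : 'I_2) = 1 :> 'I_3 by apply: val_inj.
have -> : lift ord0 (lift ord0 (ord0 : 'I_1)) = 2 :> 'I_3 by apply: val_inj.
by move: (e 0 0) (e 0 1) (e 0 2); do 3!elim/Z4_ind.
Qed.

(** A linear form on (Z/4)^4 that takes the value 1 on every cyclic shift of
    the padded vector. When the exponent sum is odd, the sum of the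
    coordinates is such a form up to a unit. When it is even, exactly one of 1
    and -1 is a root of the vector read as a polynomial. If 1 is the root, the
    coordinates of each shift sum to 0, so shifting does not change the value
    of the form with coefficients 0, 1, 2, 3. If -1 is the root, the even and
    the odd coordinates of each shift have the same sum, the odd number
    ev 1. *)
Definition weight (x : 'Z_4) : 'Z_4 :=
  if ev 0 + ev 1 + ev 2 \is a GRing.unit then ev 0 + ev 1 + ev 2
  else if ev 0 + ev 1 + ev 2 == 0 then (ev 1 + 2 * ev 2) * x
  else if odd x then 0 else ev 1.

(** Multiplication by the polynomial of the padded vector in
    Z/4[X]/(X^4 - 1), up to a shift by one: the conjugate of b whose section
    equal to b sits at the letter y has a to the power ev (x - y - 1) as its
    section at every other letter x. *)
Definition circ (k : 'Z_4 -> 'Z_4) x := \sum_y ev (x - y - 1) * k y.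

Lemma circ_shift k t x : circ (fun y => k (y + t)) x = circ k (x + t).
Proof.
rewrite /circ -[RHS](sumZ4_shift _ t); apply: eq_bigr => y _.
by rewrite opprD addrACA subrr addr0.
Qed.

Lemma circD k l x : circ (fun y => k y + l y) x = circ k x + circ l x.
Proof. by rewrite -big_split; apply: eq_bigr => y _; rewrite mulrDr. Qed.

Lemma circZ c k x : circ (fun y => c * k y) x = c * circ k x.
Proof. by rewrite /circ mulr_sumr; apply: eq_bigr => y _; rewrite mulrCA. Qed.

Lemma circ_lincomb (k : 'Z_4 -> 'Z_4 -> 'Z_4) (c : 'Z_4 -> 'Z_4) x :
  circ (fun y => \sum_z k z y * c z) x = \sum_z circ (k z) x * c z.
Proof.
rewrite /circ; under eq_bigr do rewrite mulr_sumr.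
rewrite exchange_big; apply: eq_bigr => z _.
by rewrite mulr_suml; apply: eq_bigr => y _; rewrite mulrA.
Qed.

Hypothesis he : ~ invertible_symmetric e.

Lemma weight_shift s : \sum_x weight (x + s) * ev x = 1.
Proof.
rewrite sumZ4 /weight ev3; apply/eqP; move: (unit_asym he).
by move: (ev 0) (ev 1) (ev 2) s; do 4!(elim/Z4_ind); vm_compute.
Qed.

(** With an odd exponent sum the middle entry is even and exactly one of the
    outer entries is odd, so the polynomial of the vector is a unit times
    X^i (1 + 2 t) with i = 0 or i = 2; its square is 1, hence it is its own
    inverse. *)
Lemma circ_onto_odd (c : 'Z_4 -> 'Z_4) : ev 0 + ev 1 + ev 2 \is a GRing.unit ->
  exists k, circ k =1 c.
Proof.
move=> U; exists (fun y => \sum_z ev (y - z + 1) * c z) => x.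
have inv z : circ (fun y => ev (y - z + 1)) x = (x == z)%:R.
  apply/eqP; rewrite /circ ev_cases sumZ4; move: (unit_asym he) U.
  move: (ev 0) (ev 1) (ev 2).
  do 3!elim/Z4_ind; move=> asym U; by [vm_compute in asym
    | vm_compute in U | move: x z; do 2!(elim/Z4_ind); vm_compute].
rewrite circ_lincomb (bigD1 x) //= [X in _ + X]big1 ?addr0 => [|z zx].
  by rewrite inv eqxx mul1r.
by rewrite inv eq_sym (negPf zx) mul0r.
Qed.

(** The root of the polynomial of the vector among 1 and -1, for an even
    exponent sum. *)
Definition eps : 'Z_4 := if ev 0 + ev 1 + ev 2 == 0 then 1 else -1.

Lemma circ_even k : ev 0 + ev 1 + ev 2 \isn't a GRing.unit ->
  circ k 0 + eps * circ k 1 + circ k 2 + eps * circ k 3 = 0.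
Proof.
move=> U; rewrite /circ !mulr_sumr -!big_split /= big1 // => y _.
rewrite !mulrA -!mulrDl (_ : _ + _ = 0) ?mul0r //.
apply/eqP; rewrite ev_cases /eps; move: (unit_asym he) U.
by move: (ev 0) (ev 1) (ev 2) y; do 4!(elim/Z4_ind); vm_compute.
Qed.

(** For an even exponent sum the polynomial u of the vector is a unit times
    X - eps: if ev 2 is even, then X - eps = u (ev 2 X + ev 1 + ev 2), and
    otherwise X - eps = u (ev 2 X^3 + ev 0 X^2). So the image of circ, which
    vanishes at X = eps, contains the multiples X^z - eps^z of X - eps, and
    these span the vectors that vanish at X = eps. *)
Lemma circ_onto_even (c : 'Z_4 -> 'Z_4) :
  ev 0 + ev 1 + ev 2 \isn't a GRing.unit ->
  c 0 + eps * c 1 + c 2 + eps * c 3 = 0 -> exists k, circ k =1 c.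
Proof.
move=> U c_eps.
have c0 : c 0 = - (eps * c 1 + c 2 + eps * c 3).
  by apply/eqP; rewrite -addr_eq0 !addrA c_eps.
(* The cofactor of u in X - eps, divided by X to undo the shift in circ. *)
pose v (y : 'Z_4) : 'Z_4 := if ev 0 \is a GRing.unit
  then (if y == 3 then ev 1 + ev 2 else if y == 0 then ev 2 else 0)
  else (if y == 1 then ev 0 else if y == 2 then ev 2 else 0).
have vE x : circ v x = (x == 1)%:R - eps * (x == 0)%:R.
  apply/eqP; rewrite /circ /v ev_cases sumZ4 /eps.
  move: (unit_asym he) U {c_eps c0 v}; move: (ev 0) (ev 1) (ev 2).
  do 3!elim/Z4_ind; move=> asym U; by [vm_compute in asym
    | vm_compute in U | move: x; elim/Z4_ind; vm_compute].
(* c = c 1 (X - eps) + c 2 (X^2 - 1) + c 3 (X^3 - eps) *)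
pose k y := c 1 * v y + (c 2 * (v (y - 1) + eps * v y) +
  c 3 * (v (y - 2) + (eps * v (y - 1) + v y))).
exists k => x; rewrite /k !circD !circZ !circD !circZ !circ_shift !vE.
have eps2 : eps * eps = 1.
  by rewrite /eps; case: ifP => _; rewrite ?mulrNN mulr1.
by elim/Z4_ind: x; rewrite ?c0 /=; ring: eps2.
Qed.

End DefiningVector.

Local Open Scope group_scope.

Implicit Types (f g h : tree_aut) (x y : 'Z_4).

(** * First-level decomposition of tree automorphisms *)

Definition sec f x : tree_aut := section f [:: (x : letter)].

Lemma tree_aut_eq f g : sigma f = sigma g -> sec f =1 sec g -> f = g.
Proof.
move=> fg_sigma fg_sec; apply: tree_autP => -[|x u].
  by rewrite !taut_root.
by rewrite !sigmaE fg_sigma; congr (_ :: taut _ u); apply: fg_sec.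
Qed.

Lemma sigmaM f g : sigma (f * g) = sigma f * sigma g.
Proof.
apply/permP => x; rewrite permM; apply/eqP.
have: (f * g) [:: x] = g (f [:: x]) by [].
by rewrite !sigmaE /= => -[->].
Qed.

Lemma sigma1 : sigma 1 = 1.
Proof. by apply/permP => x; rewrite permE perm1. Qed.

Lemma sigmaV f : sigma f^-1 = (sigma f)^-1.
Proof. by apply/esym/mulg1_eq; rewrite -sigmaM mulgV sigma1. Qed.

Lemma sigmaJ f g : sigma f = 1 -> sigma (f ^ g) = 1.
Proof. by move=> f1; rewrite conjgE !sigmaM sigmaV f1 mul1g mulVg. Qed.

Lemma sigmaR f g : sigma f = 1 -> sigma g = 1 -> sigma [~ f, g] = 1.
Proof.
by move=> f1 g1; rewrite commgEl sigmaM sigmaV sigmaJ // f1 invg1 mulg1.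
Qed.

Lemma sigmaX f m : sigma f = 1 -> sigma (f ^+ m) = 1.
Proof.
move=> f1; elim: m => [|m IH]; first by rewrite expg0 sigma1.
by rewrite expgS sigmaM f1 IH mulg1.
Qed.

Lemma sec1 x : sec 1 x = 1.
Proof. by apply: tree_autP => u; rewrite /sec /= /section_fun /= drop0. Qed.

Lemma secM f g x : sec (f * g) x = sec f x * sec g (sigma f x).
Proof.
apply: tree_autP => u.
have: (f * g) (x :: u) = g (f (x :: u)) by [].
by rewrite !sigmaE => -[_ E]; apply: E.
Qed.

Lemma secV f x : sigma f = 1 -> sec f^-1 x = (sec f x)^-1.
Proof.
move=> f1; apply/esym/mulg1_eq.
by have := secM f f^-1 x; rewrite mulgV sec1 f1 perm1.
Qed.

Lemma secX f m x : sigma f = 1 -> sec (f ^+ m) x = sec f x ^+ m.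
Proof.
move=> f1; elim: m => [|m IH]; first by rewrite !expg0 sec1.
by rewrite !expgS secM f1 perm1 IH.
Qed.

Lemma secR f g x : sigma f = 1 -> sigma g = 1 ->
  sec [~ f, g] x = [~ sec f x, sec g x].
Proof.
move=> f1 g1; rewrite !commgEl !conjgE !secM !sigmaV f1 g1 !invg1 !perm1.
by rewrite !secV.
Qed.

Lemma section_nil f : section f [::] = f.
Proof.
by apply: tree_autP => u; have := sectionE f [::] u; rewrite taut_root.
Qed.

Lemma section_cons f x v : section f (x :: v) = section (sec f x) v.
Proof.
apply: tree_autP => u; have := sectionE f (x :: v) u.
rewrite cat_cons !sigmaE => -[E].
have /eqP : sec f x (v ++ u) = sec f x v ++ section f (x :: v) u by exact: E.
by rewrite sectionE eqseq_cat // => /andP [_ /eqP].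
Qed.

Lemma section1 v : section 1 v = 1.
Proof.
by elim: v => [|x v IH]; rewrite ?section_nil // section_cons sec1 IH.
Qed.

Lemma sectionM f g v : section (f * g) v = section f v * section g (f v).
Proof.
elim: v f g => [|x v IH] f g; first by rewrite taut_root !section_nil.
by rewrite sigmaE !section_cons section_nil secM IH.
Qed.

Lemma commMgJ (gT : groupType) (x y z : gT) :
  [~ x * y, z] = [~ x, z] ^ y * [~ y, z].
Proof. by rewrite /commg /conjg !gnorm. Qed.

Section Assemble.
Variables (p : {perm letter}) (k : 'Z_4 -> tree_aut).

Definition assemble_fun (q : {perm letter}) (l : letter -> tree_aut)
    (v : vertex) : vertex :=
  if v is x :: u then q x :: l x u else [::].

Lemma assemble_funK :
  cancel (assemble_fun p k) (assemble_fun p^-1 (fun x => (k (p^-1 x))^-1)).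
Proof. by case=> //= x u; rewrite permK tautK. Qed.

Lemma assemble_funVK :
  cancel (assemble_fun p^-1 (fun x => (k (p^-1 x))^-1)) (assemble_fun p k).
Proof. by case=> //= x u; rewrite permKV taut_invK. Qed.

Lemma assemble_fun_homo q l : {homo assemble_fun q l : u v / child u v}.
Proof.
move=> u v /childP [y ->]; case: u => [|x u] /=.
  by rewrite taut_root; apply/childP; exists (q y).
by apply: child_cons; apply: taut_homo (child_rcons _ _).
Qed.

(** The inverse of psi. *)
Definition assemble : tree_aut :=
  tree_aut_of assemble_funK assemble_funVK
    (@assemble_fun_homo _ _) (@assemble_fun_homo _ _).

Lemma sigma_assemble : sigma assemble = p.
Proof. by apply/permP => x; rewrite [LHS]permE /sigma_fun /= taut_root. Qed.

Lemma sec_assemble x : sec assemble x = k x.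
Proof. by apply: tree_autP => u; rewrite /sec /= /section_fun /= drop0. Qed.

End Assemble.

(** The exponent of the rooted 4-cycle induced by f, meaningful when the
    action of f on the first level is a power of that cycle. *)
Definition rexp f : 'Z_4 := sigma f (0%R : 'Z_4).

Lemma rexp1 : rexp 1 = 0%R.
Proof. by rewrite /rexp sigma1 perm1. Qed.

Lemma sigma_a x : sigma ggs_a x = (x + 1)%R :> 'Z_4.
Proof.
by rewrite sigma_ggs_a permE; apply: val_inj; rewrite /= addn1.
Qed.

Lemma sec_a x : sec ggs_a x = 1.
Proof. exact: section_ggs_a. Qed.

Lemma sec_aX m x : sec (ggs_a ^+ m) x = 1.
Proof.
elim: m x => [|m IH] x; first by rewrite expg0 sec1.
by rewrite expgS secM sec_a IH mul1g.
Qed.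

Lemma sigma_aX m x : sigma (ggs_a ^+ m) x = (x + m%:R)%R :> 'Z_4.
Proof.
elim: m x => [|m IH] x; first by rewrite expg0 sigma1 perm1 addr0.
by rewrite expgS sigmaM permM sigma_a IH -addrA -(natrD _ 1).
Qed.

Lemma rexp_aX m : rexp (ggs_a ^+ m) = m%:R%R.
Proof. by rewrite /rexp sigma_aX add0r. Qed.

Lemma rexp_mul_aX h (i : 'Z_4) : sigma h = 1 -> rexp (h * ggs_a ^+ i) = i.
Proof.
by move=> h1; rewrite /rexp sigmaM h1 mul1g sigma_aX add0r Z4_natrE.
Qed.

Lemma a4 : ggs_a ^+ 4 = 1.
Proof.
apply: tree_aut_eq => [|x]; last by rewrite sec_aX sec1.
apply/permP => x; rewrite sigma_aX sigma1 perm1.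
by rewrite (_ : 4%:R = 0)%R ?addr0 //; apply: val_inj.
Qed.

Lemma aX_eq m n : m = n %[mod 4] -> ggs_a ^+ m = ggs_a ^+ n.
Proof.
have aX_mod k : ggs_a ^+ k = ggs_a ^+ (k %% 4).
  by rewrite {1}(divn_eq k 4) expgnDr mulnC expgnA a4 expg1n mul1g.
by move=> mn; rewrite aX_mod mn -aX_mod.
Qed.

Lemma commg_aX i j : [~ ggs_a ^+ i, ggs_a ^+ j] = 1.
Proof. by apply/eqP/commgP/commuteX2. Qed.

Lemma sec_conj_aX f m x : sec (f ^ (ggs_a ^+ m)) (x + m%:R)%R = sec f x.
Proof.
have := secM (ggs_a ^+ m) (f ^ (ggs_a ^+ m)) x.
by rewrite -conjgC secM !sec_aX sigma_aX mulg1 mul1g.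
Qed.

(** * Congruence quotients as finite sets of permutations *)

(** Two maps on A with the same fibres have images of the same size; every
    count below is made by exchanging the restriction to a level for a map
    with an explicit image. *)
Lemma card_fset_image (T : choiceType) (T' : finType) (A : set tree_aut)
    (F : tree_aut -> T) (F' : tree_aut -> T') (B : {pred T'}) :
  (forall f g, A f -> A g -> F f = F g <-> F' f = F' g) ->
  (forall t, t \in B <-> exists2 f, A f & F' f = t) ->
  #|` fset_set (F @` A)%classic|%fset = #|B|.
Proof.
move=> FF' AB.
have chooseA t : exists f, t \in B -> A f /\ F' f = t.
  case tB: (t \in B); last by exists 1.
  by have [/(_ tB) [f Af ft] _] := AB t; exists f.
have [c cP] := choice chooseA.
have -> : (F @` A = (F \o c) @` [set` B])%classic.
  apply/seteqP; split=> [_ [f Af <-]|_ [t tB <-]] /=.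
    have F'B : F' f \in B by apply/AB; exists f.
    have [Ac cF'] := cP _ F'B.
    by exists (F' f) => //=; apply/FF'.
  by exists (c t) => //; have [] := cP t tB.
rewrite fset_set_image; last exact: finite_finset.
rewrite card_in_imfset /=.
  rewrite (_ : fset_set _ = [fset x in B]%fset); first exact: card_finset.
  apply/fsetP => t; rewrite in_fset_set ?inE; last exact: finite_finset.
  by apply/idP/idP => [/set_mem|tB] //; apply/mem_set.
move=> t t'; rewrite !in_fset_set; try exact: finite_finset.
move=> /set_mem/cP [At ct] /set_mem/cP [At' ct'] /= Fcc.
by rewrite -ct -ct'; apply/FF'.
Qed.

Section Level.
Variable n : nat.

Definition res_fun f (u : n.-tuple letter) : n.-tuple letter :=
  tcast (etrans (size_taut f u) (size_tuple u)) (in_tuple (f u)).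

Lemma val_res_fun f u : res_fun f u = f u :> seq letter.
Proof. by rewrite val_tcast. Qed.

Lemma res_fun_inj f : injective (res_fun f).
Proof.
move=> u v /(congr1 val); rewrite /= !val_res_fun => /(bij_inj (taut_bij f)).
exact: val_inj.
Qed.

Definition res f : {perm n.-tuple letter} := perm (@res_fun_inj f).

Lemma val_res f u : res f u = f u :> seq letter.
Proof. by rewrite permE val_res_fun. Qed.

Lemma resP f g : res f = res g <-> (forall v, size v = n -> f v = g v).
Proof.
split=> [fg v vn|fg]; last first.
  apply/permP => u; apply: val_inj; rewrite /= !val_res.
  by apply: fg; rewrite size_tuple.
pose u := tcast vn (in_tuple v).
have uv : u = v :> seq letter by rewrite val_tcast.
by rewrite -uv -!val_res fg.
Qed.

Lemma resM f g : res (f * g) = res f * res g.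
Proof.
by apply/permP => u; apply: val_inj; rewrite permM /= !val_res.
Qed.

Lemma res1 : res 1 = 1.
Proof. by apply/permP => u; apply: val_inj; rewrite perm1 /= val_res. Qed.

Lemma resV f : res f^-1 = (res f)^-1.
Proof. by apply/esym/mulg1_eq; rewrite -resM mulgV res1. Qed.

Definition level_image (A : set tree_aut) : {set {perm n.-tuple letter}} :=
  [set p | `[< exists2 f, A f & res f = p >]].

Lemma level_imageP (A : set tree_aut) p :
  p \in level_image A <-> exists2 f, A f & res f = p.
Proof. by rewrite inE; split=> /asboolP. Qed.

Lemma mem_level_image (A : set tree_aut) f : A f -> res f \in level_image A.
Proof. by move=> Af; apply/level_imageP; exists f. Qed.

Lemma card_level_image (T' : finType) (A : set tree_aut)
    (F : tree_aut -> T') (B : {pred T'}) :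
  (forall f g, A f -> A g -> res f = res g <-> F f = F g) ->
  (forall t, t \in B <-> exists2 f, A f & F f = t) ->
  #|level_image A| = #|B|.
Proof.
move=> AF AB; rewrite -(card_fset_image AF AB); apply/esym.
by apply: (@card_fset_image _ _ A res res) => // p; apply: level_imageP.
Qed.

Lemma order_level_image (A : set tree_aut) : is_subgroup A ->
  congruence_quotient_order A n = #|level_image A|.
Proof.
move=> [A1 AM AV].
apply: (card_fset_image (F' := res)); last exact: level_imageP.
move=> f g Af Ag; split=> [/seteqP [sub _]|fg].
  have [h [_ hn] hg] : [set (h * g)%g | h in stab A n]%classic f.
    by apply: sub; exists 1; [split=> // v|rewrite mul1g].
  by rewrite -hg; apply/resP => v vn; rewrite tautME hn.
have sub f' g' : A f' -> A g' -> res f' = res g' ->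
    ([set h * f' | h in stab A n] `<=` [set h * g' | h in stab A n])%classic.
  move=> Af' Ag' fg' _ [h [Ah hn] <-].
  exists (h * f' * g'^-1); last by rewrite mulgVK.
  split; first exact: AM (AM _ _ Ah Af') (AV _ Ag').
  move=> v vn; rewrite !tautME hn //; move/resP: fg' => /(_ v vn) ->.
  by rewrite tautKg.
by apply/seteqP; split; apply: sub.
Qed.

End Level.

Lemma res_succ n f g : res n.+1 f = res n.+1 g <->
  sigma f = sigma g /\ forall x, res n (sec f x) = res n (sec g x).
Proof.
split=> [/resP fg|[fg_sigma fg_sec]].
  have {}fg x u : size u = n -> sigma f x = sigma g x /\ sec f x u = sec g x u.
    by move=> un; have := fg (x :: u); rewrite /= un !sigmaE => /(_ erefl) [].
  split=> [|x]; last by apply/resP => u /(fg x) [].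
  by apply/permP => x; have [] := fg x (nseq n ord0) (size_nseq _ _).
apply/resP => -[//|x u] /= [un]; rewrite !sigmaE fg_sigma; congr (_ :: _).
by have /resP := fg_sec x; apply.
Qed.

Lemma res_rexp n f g : res n.+1 f = res n.+1 g -> rexp f = rexp g.
Proof. by rewrite /rexp => /res_succ [->]. Qed.

Lemma card_level_image0 A : A 1 -> #|level_image 0 A| = 1%N.
Proof.
move=> A1; apply/eqP/cards1P; exists (res 0 1); apply/setP => p; rewrite !inE.
have p1 : p = res 0 1.
  by apply/permP => u; rewrite (tuple0 (p u)) (tuple0 (res _ _ _)).
by rewrite p1 eqxx; apply/asboolP; exists 1.
Qed.

Lemma closureP (A : set tree_aut) f :
  closure A f <-> forall n, exists2 g, A g & res n g = res n f.
Proof.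
split=> [clA n|resA B [n _ fB]].
  have nbhs_f : nbhs f [set f * s | s in level_stab n]%classic by exists n.
  have [g [Ag [s sn fg]]] := clA _ nbhs_f.
  by exists g => //; apply/resP => v vn; rewrite -fg tautME sn // size_taut.
have [g Ag /resP gf] := resA n; exists g; split=> //.
apply: fB; exists (f^-1 * g); last by rewrite mulVKg.
by move=> v vn; rewrite tautME gf ?tautVKg // -vn; apply: size_taut.
Qed.

Lemma closure_subgroup (A : set tree_aut) :
  is_subgroup A -> is_subgroup (closure A).
Proof.
move=> [A1 AM AV]; split.
- by apply/closureP => n; exists 1.
- move=> f g /closureP clf /closureP clg; apply/closureP => n.
  have [[f' Af ff] [g' Ag gg]] := (clf n, clg n).
  by exists (f' * g'); [apply: AM|rewrite !resM ff gg].
- move=> f /closureP clf; apply/closureP => n; have [f' Af ff] := clf n.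
  by exists f'^-1; [apply: AV|rewrite !resV ff].
Qed.

Lemma level_image_closure (A : set tree_aut) n :
  level_image n (closure A) = level_image n A.
Proof.
apply/setP => p; apply/idP/idP => /level_imageP [f].
  by move=> /closureP /(_ n) [g Ag <-] <-; apply: mem_level_image.
by move=> Af <-; apply: mem_level_image; apply: subset_closure.
Qed.

(** * The ambient group W4 *)

Lemma W4_subgroup : is_subgroup W4.
Proof.
split=> [v|f g Wf Wg v|f Wf v]; first by rewrite section1 sigma1 group1.
  by rewrite sectionM sigmaM groupM.
have := sectionM f f^-1 (f^-1 v); rewrite mulgV section1 tautVKg.
by move=> /esym/mulg1_eq <-; rewrite sigmaV groupV.
Qed.

Lemma W4_sigma f : W4 f -> sigma f = sigma (ggs_a ^+ rexp f).
Proof.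
move=> /(_ [::]); rewrite section_nil => /cycleP [k fk].
have {}fk : sigma f = sigma (ggs_a ^+ k).
  rewrite fk; elim: k {fk} => [|k IH]; first by rewrite expg0 sigma1.
  by rewrite !expgS sigmaM sigma_ggs_a IH.
apply/permP => x; rewrite {1}fk !sigma_aX Z4_natrE; congr (_ + _)%R.
by rewrite /rexp fk sigma_aX add0r.
Qed.

Lemma W4_sec f x : W4 f -> W4 (sec f x).
Proof. by move=> Wf v; rewrite -section_cons. Qed.

(** W4 is the full wreath product of itself with the cyclic group of order
    4: the first-level action and the four sections are independent. *)
Lemma card_level_image_W4S n :
  #|level_image n.+1 W4| = (4 * #|level_image n W4| ^ 4)%N.
Proof.
pose F f := (rexp f, [ffun x => res n (sec f x)]).
pose B := [predX (predT : pred 'Z_4) & @ffun_on 'Z_4 (level_image n W4)].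
rewrite (@card_level_image _ _ _ F B).
- by rewrite cardX card_ffun_on !card_Z4.
- move=> f g Wf Wg; split=> [fg|[fg_rexp /ffunP fg_sec]].
    rewrite /F (res_rexp fg); congr pair; apply/ffunP => x; rewrite !ffunE.
    by case/res_succ: fg.
  apply/res_succ; split; first by rewrite W4_sigma // fg_rexp -W4_sigma.
  by move=> x; have := fg_sec x; rewrite !ffunE.
- move=> [i t]; rewrite inE /=; split; last first.
    move=> [f Wf [_ <-]]; apply/ffun_onP => x; rewrite ffunE.
    exact/mem_level_image/W4_sec.
  move=> /ffun_onP tW.
  have /choice [p pW] x : exists k, W4 k /\ res n k = t x.
    by have /level_imageP [k Wk kt] := tW x; exists k.
  exists (assemble (sigma (ggs_a ^+ i)) p).
    move=> [|x v]; last by rewrite section_cons sec_assemble; apply: (pW x).1.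
    rewrite section_nil sigma_assemble.
    elim: (i : nat) => [|k IH]; first by rewrite expg0 sigma1 group1.
    by rewrite expgS sigmaM sigma_ggs_a groupM // cycle_id.
  congr pair; first by rewrite /rexp sigma_assemble sigma_aX add0r Z4_natrE.
  by apply/ffunP => x; rewrite ffunE sec_assemble (pW x).2.
Qed.

Lemma card_level_image_W4 n :
  exists2 w, #|level_image n W4| = (4 ^ w)%N & ((3 * w).+1 = 4 ^ n)%N.
Proof.
elim: n => [|n [w IH w3]].
  by exists 0%N => //; apply: card_level_image0; have [] := W4_subgroup.
exists (4 * w).+1%N.
  by rewrite card_level_image_W4S IH -expnM expnS (mulnC w).
by rewrite expnS -w3 !mulnS mulnCA.
Qed.

Section GGS.
Variable e : 'rV['Z_4]_3.
Local Notation a := ggs_a.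
Local Notation b := (ggs_b e).
Local Notation G := (GGS e).
Local Notation ev := (ev e).
Local Notation circ := (circ e).
Local Notation weight := (weight e).
Local Notation eps := (eps e).

(** * The GGS-group *)

Lemma sec_b x : sec b x = if x == 3%R then b else a ^+ ev x.
Proof.
rewrite /sec; case: eqP => [->|/eqP x3].
  by rewrite (_ : 3%R = ord_max) ?section_ggs_b_max //; apply: val_inj.
rewrite /ev; case: unliftP => [i ->|x_max]; first exact: section_ggs_b_lift.
by case/eqP: x3; rewrite x_max; apply: val_inj.
Qed.

Lemma sigma_b x : sigma b x = x.
Proof. by rewrite sigma_ggs_b perm1. Qed.

Lemma sigma_bX m : sigma (b ^+ m) = 1.
Proof. exact/sigmaX/sigma_ggs_b. Qed.

Lemma rexp_bX m : rexp (b ^+ m) = 0%R.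
Proof. by rewrite /rexp sigma_bX perm1. Qed.

Lemma rexp_sec_b x : rexp (sec b x) = ev x.
Proof.
rewrite sec_b; case: eqP => [->|_]; first by rewrite ev3 -(expg1 b) rexp_bX.
by rewrite rexp_aX Z4_natrE.
Qed.

Lemma b4 : b ^+ 4 = 1.
Proof.
apply: tree_autP; elim=> [|x u IH]; first by rewrite taut_root.
rewrite sigmaE sigma_bX perm1; congr (_ :: _).
have -> : section (b ^+ 4) [:: x] = sec b x ^+ 4.
  exact: secX (sigma_ggs_b e).
by rewrite sec_b; case: eqP => // _; rewrite -expgnA mulnC expgnA a4 expg1n.
Qed.

Lemma GGS_subgroup : is_subgroup G.
Proof.
split=> [S [[]] //|f g Gf Gg S SG|f Gf S SG].
  by have [[_ SM _] _] := SG; apply: SM; [apply: Gf|apply: Gg].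
by have [[_ _ SV] _] := SG; apply: SV; apply: Gf.
Qed.

Lemma GGS1 : G 1. Proof. by have [] := GGS_subgroup. Qed.

Lemma GGSM f g : G f -> G g -> G (f * g).
Proof. by have [_ + _] := GGS_subgroup; apply. Qed.

Lemma GGSV f : G f -> G f^-1.
Proof. by have [_ _] := GGS_subgroup; apply. Qed.

Lemma GGSX f m : G f -> G (f ^+ m).
Proof.
move=> Gf; elim: m => [|m IH]; first exact: GGS1.
by rewrite expgS; apply: GGSM.
Qed.

Lemma GGSa : G a. Proof. by move=> S [_ +]; apply; left. Qed.
Lemma GGSb : G b. Proof. by move=> S [_ +]; apply; right. Qed.
Lemma GGSaX m : G (a ^+ m). Proof. exact: GGSX GGSa. Qed.
Lemma GGSbX m : G (b ^+ m). Proof. exact: GGSX GGSb. Qed.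

Lemma GGSJ f g : G f -> G g -> G (f ^ g).
Proof. by move=> Gf Gg; rewrite conjgE; do ![apply: GGSM|apply: GGSV]. Qed.

Lemma GGSR f g : G f -> G g -> G [~ f, g].
Proof.
by move=> Gf Gg; rewrite commgEl; apply: GGSM; [apply: GGSV|apply: GGSJ].
Qed.

(** As a and b have order 4, every element of G is a product of copies of a
    and b without inverses. *)
Lemma GGS_ind (P : tree_aut -> Prop) : P 1 ->
  (forall g, G g -> P g -> P (a * g)) -> (forall g, G g -> P g -> P (b * g)) ->
  forall g, G g -> P g.
Proof.
move=> P1 Pa Pb g Gg.
pose H := [set f | forall g, G g -> P g -> P (f * g)]%classic.
pose S := [set f | [/\ G f, H f & H f^-1]]%classic.
have HX f m : G f -> H f -> H (f ^+ m).
  move=> Gf Hf; elim: m => [|m IH] h Gh Ph; first by rewrite expg0 mul1g.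
  by rewrite expgS -mulgA; apply: Hf; [apply: GGSM (GGSX _ Gf) Gh|apply: IH].
have V4 f : f ^+ 4 = 1 -> f^-1 = f ^+ 3.
  by move=> f4; apply: mulg1_eq; rewrite -expgS.
have Sab f : f ^+ 4 = 1 -> G f -> H f -> S f.
  by move=> f4 Gf Hf; split=> //; rewrite V4 //; apply: HX.
have SG : is_subgroup S.
  split=> [|f h [Gf Hf Hf'] [Gh Hh Hh']|f [Gf Hf Hf']].
  - by split; rewrite ?invg1; [apply: GGS1|move=> h|move=> h]; rewrite mul1g.
  - split; first exact: GGSM.
      by move=> k Gk Pk; rewrite -mulgA; apply: Hf; [apply: GGSM|apply: Hh].
    move=> k Gk Pk; rewrite invgM -mulgA; apply: Hh'; last exact: Hf'.
    by apply: GGSM => //; apply: GGSV.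
  - by split; rewrite ?invgK //; apply: GGSV.
have [] := Gg S.
  by split=> // f [->|->]; apply: Sab;
    rewrite ?a4 ?b4 //; [apply: GGSa|apply: GGSb].
by move=> _ Hg _; rewrite -[g]mulg1; apply: Hg; [apply: GGS1|].
Qed.

Lemma sigma_G g x : G g -> sigma g x = (x + rexp g)%R :> 'Z_4.
Proof.
move=> Gg; elim/GGS_ind: g / Gg x => [|g Gg IH|g Gg IH] x.
- by rewrite /rexp sigma1 !perm1 addr0.
- by rewrite /rexp !sigmaM !permM !sigma_a !IH add0r -addrA.
- by rewrite /rexp !sigmaM !permM !sigma_b !IH add0r.
Qed.

Lemma GGS_sigma f : G f -> sigma f = sigma (a ^+ rexp f).
Proof.
by move=> Gf; apply/permP => x; rewrite sigma_aX Z4_natrE (sigma_G _ Gf).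
Qed.

Lemma rexpM f g : G g -> rexp (f * g) = (rexp f + rexp g)%R.
Proof. by move=> Gg; rewrite {1}/rexp sigmaM permM (sigma_G _ Gg). Qed.

Lemma secM_G f g x : G f -> sec (f * g) x = sec f x * sec g (x + rexp f)%R.
Proof. by move=> Gf; rewrite secM sigma_G. Qed.

Lemma GGS_sec g x : G g -> G (sec g x).
Proof.
move=> Gg; elim/GGS_ind: g / Gg x => [|g Gg IH|g Gg IH] x.
- by rewrite sec1; apply: GGS1.
- by rewrite secM sec_a mul1g.
- rewrite secM sigma_b sec_b; apply: GGSM => //.
  by case: eqP => _; [apply: GGSb|apply: GGSaX].
Qed.

(** * The two exponent homomorphisms *)

(** The exponent of b. It is read off the second level, as the value of the
    form weight on the exponents of a in the four sections; betaM and beta_b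
    show that this is well behaved on G. *)
Definition beta f : 'Z_4 := (\sum_x weight x * rexp (sec f x))%R.

Lemma beta1 : beta 1 = 0%R.
Proof. by rewrite /beta big1 // => x _; rewrite sec1 rexp1 mulr0. Qed.

Lemma beta_aX m : beta (a ^+ m) = 0%R.
Proof. by rewrite /beta big1 // => x _; rewrite sec_aX rexp1 mulr0. Qed.

Hypothesis he : ~ invertible_symmetric e.

(** Multiplying by a on the left shifts the four sections cyclically, and
    multiplying by b adds to them the defining vector, on every shift of
    which the form takes the value 1. So all shifts of the form agree on
    G. *)
Lemma beta_shift g s : G g ->
  (\sum_x weight (x + s) * rexp (sec g x))%R = beta g.
Proof.
pose bt h t := (\sum_x weight (x + t) * rexp (sec h x))%R.
have bt0 h : beta h = bt h 0%R.
  by apply: eq_bigr => x _; rewrite addr0.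
rewrite bt0 -/(bt g s) => Gg; elim/GGS_ind: g / Gg s => [|g Gg IH|g Gg IH] s.
- by rewrite /bt !big1 // => x _; rewrite sec1 rexp1 mulr0.
- have bta t : bt (a * g) t = bt g (t - 1)%R.
    rewrite /bt -[RHS](sumZ4_shift _ 1%R); apply: eq_bigr => x _.
    by rewrite secM sec_a mul1g sigma_a addrACA subrr addr0.
  by rewrite !bta IH [RHS]IH.
- have btb t : bt (b * g) t = (1 + bt g t)%R.
    rewrite -(weight_shift he t) -big_split; apply: eq_bigr => x _.
    by rewrite secM sigma_b rexpM ?rexp_sec_b ?mulrDr //; apply: GGS_sec.
  by rewrite !btb IH.
Qed.

Lemma betaM f g : G f -> G g -> beta (f * g) = (beta f + beta g)%R.
Proof.
move=> Gf Gg; rewrite -(beta_shift (- rexp f)%R Gg).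
rewrite -[X in (_ + X)%R](sumZ4_shift _ (rexp f)) -big_split.
apply: eq_bigr => x _; rewrite secM_G // rexpM; last exact: GGS_sec.
by rewrite mulrDr addrK.
Qed.

Lemma betaX f m : G f -> beta (f ^+ m) = (m%:R * beta f)%R.
Proof.
move=> Gf; elim: m => [|m IH]; first by rewrite expg0 beta1 mul0r.
by rewrite expgS betaM ?IH; [rewrite mulrS mulrDl mul1r| |apply: GGSX].
Qed.

Lemma beta_b : beta b = 1%R.
Proof.
rewrite /beta -[RHS](weight_shift he 0%R); apply: eq_bigr => x _.
by rewrite rexp_sec_b addr0.
Qed.

Lemma beta_sec_b x : beta (sec b x) = (x == 3)%:R%R.
Proof. by rewrite sec_b; case: eqP => _; rewrite ?beta_b ?beta_aX. Qed.

(** An element of G that fixes the first level is a product of conjugates of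
    b by powers of a. The value of beta on its section at y counts those
    conjugates that have b at y, and each of them contributes a known power of
    a to the other sections. *)
Definition balanced f := forall x,
  rexp (sec f x) = circ (fun y => beta (sec f y)) x.

Lemma balancedM f g : G f -> (forall x, G (sec g x)) ->
  balanced f -> balanced g -> balanced (f * g).
Proof.
move=> Gf Gg bf bg x; rewrite secM_G // rexpM // bf bg -circ_shift -circD.
congr (circ _ _); apply/funext => y.
by rewrite secM_G // betaM //; apply: GGS_sec.
Qed.

Lemma GGS_balanced g : G g -> balanced g.
Proof.
move=> Gg; elim/GGS_ind: g / Gg => [x|g Gg bg|g Gg bg].
- rewrite sec1 rexp1 /circ big1 // => y _; by rewrite sec1 beta1 mulr0.
- apply: balancedM => //; [exact: GGSa|by move=> x; apply: GGS_sec|].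
  move=> x; rewrite sec_a rexp1 /circ big1 // => y _.
  by rewrite sec_a beta1 mulr0.
- apply: balancedM => //; [exact: GGSb|by move=> x; apply: GGS_sec|].
  move=> x; rewrite rexp_sec_b /circ (bigD1 3%R) //= big1 => [|y /negPf y3].
    rewrite beta_sec_b mulr1 addr0 -addrA -opprD.
    by rewrite (_ : 3 + 1 = 0)%R ?subr0 //; apply: val_inj.
  by rewrite beta_sec_b y3 mulr0.
Qed.

(** * Branching: the derived subgroup acts independently on the subtrees *)

Definition single x n := assemble 1 (fun y => if y == x then n else 1).

Lemma sigma_single x n : sigma (single x n) = 1.
Proof. exact: sigma_assemble. Qed.

Lemma sec_single x n y : sec (single x n) y = if y == x then n else 1.
Proof. exact: sec_assemble. Qed.

Lemma singleM x (n m : tree_aut) : single x n * single x m = single x (n * m).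
Proof.
apply: tree_aut_eq => [|y]; first by rewrite sigmaM !sigma_single mulg1.
by rewrite secM sigma_single perm1 !sec_single; case: eqP; rewrite ?mulg1.
Qed.

Lemma single1 x : single x 1 = 1.
Proof.
apply: tree_aut_eq => [|y]; first by rewrite sigma_single sigma1.
by rewrite sec_single sec1; case: eqP.
Qed.

Lemma singleV x n : single x n^-1 = (single x n)^-1.
Proof. by apply/esym/mulg1_eq; rewrite singleM mulgV single1. Qed.

Lemma single_conj_b x n : single x n ^ b = single x (n ^ sec b x).
Proof.
apply: (mulgI b); rewrite -conjgC; apply: tree_aut_eq => [|y].
  by rewrite !sigmaM !sigma_single mulg1 mul1g.
rewrite !secM !sec_single sigma_single perm1 sigma_b.
by case: eqP => [->|_]; rewrite -?conjgC ?mulg1 ?mul1g.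
Qed.

Lemma single_conj_aX x n m : single x n ^ (a ^+ m) = single (x + m%:R)%R n.
Proof.
apply: (mulgI (a ^+ m)); rewrite -conjgC; apply: tree_aut_eq => [|y].
  by rewrite !sigmaM !sigma_single mulg1 mul1g.
rewrite !secM !sec_single !sec_aX sigma_aX mulg1 mul1g.
by rewrite (inj_eq (addIr _)).
Qed.

(** The elements that G realizes on one first-level subtree while it fixes
    the other three pointwise. *)
Definition rist n := forall x, G (single x n).

Lemma rist_at x n : G (single x n) -> rist n.
Proof.
move=> Gn y; rewrite -[y](subrK x) addrC -(Z4_natrE (y - x)%R).
by rewrite -single_conj_aX; apply: GGSJ => //; apply: GGSaX.
Qed.

Lemma rist1 : rist 1.
Proof. by move=> x; rewrite single1; apply: GGS1. Qed.

Lemma ristM (n m : tree_aut) : rist n -> rist m -> rist (n * m).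
Proof. by move=> rn rm x; rewrite -singleM; apply: GGSM. Qed.

Lemma ristV n : rist n -> rist n^-1.
Proof. by move=> rn x; rewrite singleV; apply: GGSV. Qed.

Lemma rist_conj_sec_b n x : rist n -> rist (n ^ sec b x).
Proof.
move=> rn; apply: (@rist_at x); rewrite -single_conj_b.
by apply: GGSJ => //; apply: GGSb.
Qed.

Lemma unit_ev : exists2 i, i != 3%R & ev i \is a GRing.unit.
Proof.
have := unit_asym he.
have [u0 _|_ /esym/negbFE u2] := boolP (ev 0 \is a GRing.unit)%R.
  by exists 0%R.
by exists 2%R.
Qed.

(** The sections of b include b and, as some entry of the defining vector is
    odd, a generator of the cyclic group of a; conjugating by b realizes
    conjugation by each of them on a subtree. *)
Lemma ristJ g n : G g -> rist n -> rist (n ^ g).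
Proof.
move=> Gg; elim/GGS_ind: g / Gg n => [|g Gg IH|g Gg IH] n rn.
- by rewrite conjg1.
- rewrite conjgM; apply: IH.
  have [i i3 ui] := unit_ev.
  have rX m : rist (n ^ (a ^+ (ev i * m))).
    elim: m => [|m IHm]; first by rewrite muln0 expg0 conjg1.
    rewrite mulnSr expgnDr conjgM.
    by have := rist_conj_sec_b i IHm; rewrite sec_b (negPf i3).
  (* The square of an odd number is 1 modulo 4. *)
  have := rX (ev i); rewrite (@aX_eq _ 1) ?expg1 //.
  by move: ui; elim/Z4_ind: (ev i).
- rewrite conjgM; apply: IH.
  by have := rist_conj_sec_b 3%R rn; rewrite sec_b eqxx.
Qed.

Lemma rist_GGS n : rist n -> G n.
Proof. by move=> /(_ 0%R) /(GGS_sec 0%R); rewrite sec_single eqxx. Qed.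

(** Balance for an element with one nontrivial section n at the letter 4:
    the trivial section at an odd entry of the defining vector forces
    beta n = 0, and then the section n itself has exponent 0. *)
Lemma rist_rexp_beta n : rist n -> rexp n = 0%R /\ beta n = 0%R.
Proof.
move=> /(_ 3%R) /GGS_balanced bal.
have {bal} bal x : rexp (if x == 3%R then n else 1) = (ev x * beta n)%R.
  have := bal x; rewrite sec_single => ->.
  rewrite /circ (bigD1 3%R) //= big1 => [|y /negPf y3].
    rewrite sec_single eqxx addr0 -addrA -opprD.
    by rewrite (_ : 3 + 1 = 0)%R ?subr0 //; apply: val_inj.
  by rewrite sec_single y3 beta1 mulr0.
have [i /negPf i3 ui] := unit_ev.
have beta0 : beta n = 0%R.
  by apply: (mulrI ui); rewrite -bal i3 rexp1 mulr0.
by split=> //; have := bal 3%R; rewrite eqxx beta0 mulr0.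
Qed.

(** The commutator of a power of b and a power of its shift b ^ a dies on
    the two inner letters, where both sections are powers of a. *)
Lemma two_commutators m l :
  G (single 0%R [~ a ^+ (ev 0%R * m), b ^+ l] *
     single 3%R [~ b ^+ m, a ^+ (ev 2%R * l)]).
Proof.
suff <- : [~ b ^+ m, (b ^ a) ^+ l] =
    single 0%R [~ a ^+ (ev 0%R * m), b ^+ l] *
    single 3%R [~ b ^+ m, a ^+ (ev 2%R * l)].
  apply: GGSR; first exact: GGSbX.
  by apply: GGSX; apply: GGSJ; [apply: GGSb|apply: GGSa].
have b1 := sigma_ggs_b e.
have ba1 : sigma (b ^ a) = 1 by apply: sigmaJ.
have [b1m ba1l] := (sigmaX m b1, sigmaX l ba1).
apply: tree_aut_eq => [|x].
  by rewrite sigmaR // sigmaM !sigma_single mulg1.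
rewrite secR // !secX // secM sigma_single perm1 !sec_single.
have -> : sec (b ^ a) x = sec b (x - 1)%R.
  by rewrite -{1}[x](subrK 1%R); apply: (sec_conj_aX b 1).
rewrite !sec_b.
elim/Z4_ind: x; rewrite /= ?mul1g ?mulg1 -?expgnA ?commg_aX //.
by rewrite (_ : 3 - 1 = 2)%R //; apply: val_inj.
Qed.

Definition commute_rist (i j : nat) := rist [~ a ^+ i, b ^+ j].

Lemma commute_rist_swap m l :
  commute_rist (ev 0%R * m) l <-> commute_rist (ev 2%R * l) m.
Proof.
rewrite /commute_rist -[X in _ <-> rist X]invgR.
have := two_commutators m l; move: [~ _, _] [~ _, _] => v u Guv.
split=> [ru|rv].
  apply: ristV; apply: (@rist_at 3%R).
  rewrite -[single _ _](mulKg (single 0%R u)).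
  by apply: GGSM _ Guv; apply: GGSV; apply: ru.
apply: (@rist_at 0%R); rewrite -[single _ _](mulgK (single 3%R v)).
by apply: (GGSM Guv); apply: GGSV; rewrite -[v]invgK; apply: ristV.
Qed.

Lemma commute_ristM i j m : commute_rist i j -> commute_rist (i * m) j.
Proof.
rewrite /commute_rist => C; elim: m => [|m IH].
  by rewrite muln0 expg0 comm1g; apply: rist1.
rewrite mulnS expgnDr commMgJ; apply: ristM => //.
by apply: ristJ => //; apply: GGSaX.
Qed.

Lemma commute_rist_mod i i' j :
  i = i' %[mod 4] -> commute_rist i j -> commute_rist i' j.
Proof. by move=> /aX_eq; rewrite /commute_rist => ->. Qed.

Lemma commute_rist0 j : commute_rist 0 j.
Proof. by rewrite /commute_rist expg0 comm1g; apply: rist1. Qed.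

(** With p odd and q even, the exchange rule climbs from trivial commutators:
    2 q = 0 modulo 4 gives the pair (p, 2), whose multiples include (1, 2)
    and (q, 2); the latter gives (2 p, 1) = (2, 1), whose multiples include
    (q, 1), and this gives (p, 1). *)
Lemma commute_rist_bootstrap (p q : nat) :
  odd p -> ~~ odd q -> (p < 4)%N -> (q < 4)%N ->
  (forall m l, commute_rist (p * m) l <-> commute_rist (q * l) m) ->
  commute_rist 1 1.
Proof.
move=> po qe p4 q4 swap.
have C1 j : commute_rist p j -> commute_rist 1 j.
  move=> /(@commute_ristM _ _ p); apply: commute_rist_mod.
  by case: p po p4 {swap} => [|[|[|[]]]].
have C12 : commute_rist 1 2.
  apply: C1; rewrite -[p]muln1; apply/swap.
  apply: commute_rist_mod (commute_rist0 1).
  by case: q qe q4 {swap} => [|[|[|[]]]].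
have C21 : commute_rist 2 1.
  have: commute_rist (p * 2) 1.
    by apply/swap; rewrite muln1 -[q]mul1n; apply: commute_ristM.
  by apply: commute_rist_mod; case: p po p4 {swap C1} => [|[|[|[]]]].
apply: C1; rewrite -[p]muln1; apply/swap; rewrite muln1.
by rewrite -(odd_double_half q) (negPf qe) add0n -mul2n; apply: commute_ristM.
Qed.

Lemma commute_rist_ab : commute_rist 1 1.
Proof.
have := unit_asym he; rewrite -!Z4_odd.
have [odd0|even0] := boolP (odd (ev 0%R)).
  move/esym => even2; apply: (commute_rist_bootstrap odd0 even2) => //.
  exact: commute_rist_swap.
move=> /esym/negbFE odd2; apply: (commute_rist_bootstrap odd2 even0) => // m l.
exact: iff_sym (commute_rist_swap l m).
Qed.

(** The subgroup rist is normal in G and contains [a, b], so a and b commute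
    modulo it. *)
Lemma GGS_normal_form g :
  G g -> exists i j n, rist n /\ g = a ^+ i * b ^+ j * n.
Proof.
move=> Gg.
elim/GGS_ind: g / Gg => [|g _ [i [j [n [rn ->]]]]|g _ [i [j [n [rn ->]]]]].
- by exists 0%N, 0%N, 1; split; [apply: rist1|rewrite !expg0 !mulg1].
- by exists i.+1, j, n; split => //; rewrite expgS !mulgA.
- exists i, j.+1, ([~ b, a ^+ i] ^ (b ^+ j) * n); split.
    apply: ristM => //; apply: ristJ; first exact: GGSbX.
    rewrite -invgR; apply: ristV.
    by have := commute_ristM i commute_rist_ab; rewrite mul1n.
  rewrite expgS !mulgA (commgC b) -!mulgA; congr (_ * (_ * _)).
  by rewrite mulVKg.
Qed.

Lemma ristP g : G g -> rexp g = 0%R -> beta g = 0%R -> rist g.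
Proof.
move=> Gg; have [i [j [n [rn ->]]]] := GGS_normal_form Gg.
have [n0 bn0] := rist_rexp_beta rn; have Gn := rist_GGS rn.
have Gi := GGSaX i; have Gj := GGSbX j; have Gij := GGSM Gi Gj.
rewrite (rexpM _ Gn) (rexpM _ Gj) rexp_aX rexp_bX n0 !addr0 => /natr_mod4 i4.
rewrite !betaM // beta_aX (betaX _ GGSb) beta_b bn0 add0r addr0 mulr1.
move=> /natr_mod4 j4; rewrite -(divnK i4) -(divnK j4).
by rewrite mulnC expgnA a4 mulnC expgnA b4 !expg1n !mul1g.
Qed.

(** The conjugates of b by powers of a have their section equal to b at each
    of the four letters in turn. *)
Lemma exists_beta_sec (k : 'Z_4 -> 'Z_4) :
  exists r, [/\ G r, sigma r = 1 & forall x, beta (sec r x) = k x].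
Proof.
pose sum_delta s x := (\sum_(y <- s) k y * (x == y)%:R)%R.
suff [r [Gr r1 rk]] : exists r, [/\ G r, sigma r = 1 &
    forall x, beta (sec r x) = sum_delta (index_enum _) x].
  exists r; split=> // x; rewrite rk /sum_delta (bigD1 x) //= eqxx mulr1.
  by rewrite big1 ?addr0 // => y; rewrite eq_sym => /negPf ->; rewrite mulr0.
elim: (index_enum _) => [|y s [r [Gr r1 rk]]].
  exists 1; split=> [||x]; [exact: GGS1|exact: sigma1|].
  by rewrite sec1 beta1 /sum_delta big_nil.
pose c := b ^ (a ^+ (y + 1)%R).
have Gc : G c by apply: GGSJ; [apply: GGSb|apply: GGSaX].
have c1 : sigma c = 1 by apply: sigmaJ; apply: sigma_ggs_b.
exists (c ^+ k y * r); split=> [||x].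
- by apply: GGSM => //; apply: GGSX.
- by rewrite sigmaM sigmaX // r1 mulg1.
rewrite secM sigmaX // perm1 secX // betaM;
  [|exact: GGSX (GGS_sec _ Gc)|exact: GGS_sec].
rewrite /sum_delta big_cons rk betaX ?Z4_natrE; last exact: GGS_sec.
congr (_ * _ + _)%R.
rewrite -{1}[x](subrK (y + 1)%R) -{2}(Z4_natrE (y + 1)%R) sec_conj_aX.
rewrite beta_sec_b; congr (_%:R)%R; rewrite subr_eq addrC -addrA.
by rewrite (_ : 1 + 3 = 0)%R ?addr0 //; apply: val_inj.
Qed.

(** The converse of balance: dividing h by an element of G with the same
    beta on all sections leaves an element whose sections have both
    exponents zero, hence lie in rist. *)
Lemma GGS_from_sections h : sigma h = 1 ->
  (forall x, G (sec h x)) -> balanced h -> G h.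
Proof.
move=> h1 Gh bh.
have [r [Gr r1 rk]] := exists_beta_sec (fun x => beta (sec h x)).
have [Grv rv1] : G r^-1 /\ sigma r^-1 = 1.
  by split; [exact: GGSV|rewrite sigmaV r1 invg1].
have [g gE] : {g | g = r^-1 * h} by exists (r^-1 * h).
have g1 : sigma g = 1 by rewrite gE sigmaM rv1 h1 mulg1.
have bg : balanced g by rewrite gE; apply: balancedM => //; apply: GGS_balanced.
have Ggx x : G (sec g x).
  by rewrite gE secM_G //; apply: GGSM => //; apply: GGS_sec.
have beta_g x : beta (sec g x) = 0%R.
  have Grx : G (sec r x) by exact: GGS_sec.
  apply: (addrI (beta (sec r x))); rewrite -betaM // rk addr0.
  by rewrite gE secM rv1 perm1 secV // mulVKg.
have rg x : rist (sec g x).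
  apply: ristP => //.
  by rewrite bg /circ big1 // => y _; rewrite beta_g mulr0.
suff Gg : G g by have := GGSM Gr Gg; rewrite gE mulVKg.
have -> : g = single 0%R (sec g 0%R) * single 1%R (sec g 1%R) *
              (single 2%R (sec g 2%R) * single 3%R (sec g 3%R)).
  apply: tree_aut_eq => [|x]; first by rewrite g1 !sigmaM !sigma_single !mulg1.
  rewrite !secM !sigmaM !sigma_single !mulg1 !perm1 !sec_single.
  by elim/Z4_ind: x; rewrite /= ?mul1g ?mulg1.
by apply: GGSM; apply: GGSM; apply: rg.
Qed.

(** * Orders of the congruence quotients *)

Lemma res_succ_GGS n f g : G f -> G g -> res n.+1 f = res n.+1 g <->
  rexp f = rexp g /\ forall x, res n (sec f x) = res n (sec g x).
Proof.
move=> Gf Gg; rewrite (propext (res_succ n f g)).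
split=> -[fg_sigma fg_sec]; split=> //; first by rewrite /rexp fg_sigma.
by rewrite (GGS_sigma Gf) fg_sigma -(GGS_sigma Gg).
Qed.

Lemma res1_GGS f g : G f -> G g -> res 1 f = res 1 g <-> rexp f = rexp g.
Proof.
move=> Gf Gg; rewrite (propext (res_succ_GGS 0 Gf Gg)).
split=> [[]//|fg]; split=> // x.
by apply/resP => v /size0nil ->; rewrite !taut_root.
Qed.

Lemma res2_GGS f g : G f -> G g -> res 2 f = res 2 g <->
  rexp f = rexp g /\ forall x, rexp (sec f x) = rexp (sec g x).
Proof.
move=> Gf Gg; rewrite (propext (res_succ_GGS 1 Gf Gg)).
by split=> -[fg fg_sec]; split=> // x;
  apply/(res1_GGS (GGS_sec x Gf) (GGS_sec x Gg)).
Qed.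

Lemma res_beta n f g : res n.+2 f = res n.+2 g -> beta f = beta g.
Proof.
move=> /res_succ [_ fg]; apply: eq_bigr => x _.
by rewrite (res_rexp (fg x)).
Qed.

(** On the second level the sections of G realize exactly the vectors in the
    image of circ. *)
Lemma exists_sec_rexp k i : exists g, [/\ G g, rexp g = i &
  forall x, rexp (sec g x) = circ k x].
Proof.
have [r [Gr r1 rk]] := exists_beta_sec k; exists (r * a ^+ i); split.
- by apply: GGSM Gr _; apply: GGSaX.
- exact: rexp_mul_aX.
- move=> x; rewrite secM sec_aX mulg1 (GGS_balanced Gr).
  by congr (circ _ _); apply/funext => y; apply: rk.
Qed.

Lemma card_level_image2_odd : (ev 0 + ev 1 + ev 2)%R \is a GRing.unit ->
  #|level_image 2 G| = (4 ^ 5)%N.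
Proof.
move=> U; pose F f := (rexp f, [ffun x => rexp (sec f x)]).
rewrite (@card_level_image _ _ _ F (predT : pred ('Z_4 * {ffun 'Z_4 -> 'Z_4}))).
- by rewrite card_prod card_ffun !card_Z4.
- move=> f g Gf Gg; rewrite (propext (res2_GGS Gf Gg)).
  split=> [[fg fg_sec]|[fg /ffunP fg_sec]].
    by rewrite /F fg; congr pair; apply/ffunP => x; rewrite !ffunE.
  by split=> // x; have := fg_sec x; rewrite !ffunE.
- move=> [i t]; split=> // _.
  have [k kt] := circ_onto_odd he t U.
  have [g [Gg gi gk]] := exists_sec_rexp k i.
  exists g => //; rewrite /F gi; congr pair; apply/ffunP => x.
  by rewrite ffunE gk kt.
Qed.

(** The image of circ is a hyperplane on which the coordinate at 0 is a
    function of the other three. *)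
Lemma card_level_image2_even : (ev 0 + ev 1 + ev 2)%R \isn't a GRing.unit ->
  #|level_image 2 G| = (4 ^ 4)%N.
Proof.
move=> U; pose F f :=
  (rexp f, (rexp (sec f 1%R), rexp (sec f 2%R), rexp (sec f 3%R))).
pose B := (predT : pred ('Z_4 * ('Z_4 * 'Z_4 * 'Z_4))).
rewrite (@card_level_image _ _ _ F B).
- by rewrite !card_prod !card_Z4.
- have sec0 f : G f -> (rexp (sec f 0) =
      - (eps * rexp (sec f 1) + rexp (sec f 2) + eps * rexp (sec f 3)))%R.
    move=> Gf; apply/eqP; rewrite -addr_eq0 !addrA !(GGS_balanced Gf).
    by rewrite circ_even.
  move=> f g Gf Gg; rewrite (propext (res2_GGS Gf Gg)).
  split=> [[fg fg_sec]|]; first by rewrite /F fg !fg_sec.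
  case=> fg fg1 fg2 fg3; split=> //; elim/Z4_ind => //.
  by rewrite !sec0 // fg1 fg2 fg3.
- move=> [i [[t1 t2] t3]]; split=> // _.
  pose t x := (if x == 0 then - (eps * t1 + t2 + eps * t3) else
               if x == 1 then t1 else if x == 2 then t2 else t3)%R.
  have [|k kt] := circ_onto_even (c := t) he U.
    by rewrite /t /= -!addrA addNr.
  have [g [Gg gi gk]] := exists_sec_rexp k i.
  by exists g => //; rewrite /F gi !gk !kt.
Qed.

(** This is the derived subgroup of G: the abelianization of G is generated by
    two elements of order dividing 4, and rexp and beta map it onto
    Z/4 x Z/4, hence isomorphically. *)
Definition exp_kernel : set tree_aut :=
  [set g | [/\ G g, rexp g = 0%R & beta g = 0%R]]%classic.

Definition kernel_part g := b ^- (beta g) * (a ^- (rexp g) * g).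

Lemma kernel_partE g : g = a ^+ rexp g * (b ^+ (beta g) * kernel_part g).
Proof. by rewrite /kernel_part !mulVKg. Qed.

Lemma exp_kernel_part g : G g -> exp_kernel (kernel_part g).
Proof.
move=> Gg.
have Gb : G (b ^+ beta g) by apply: GGSbX.
have Ga : G (a ^+ rexp g) by apply: GGSaX.
have Gk : G (kernel_part g) by exact: GGSM (GGSV Gb) (GGSM (GGSV Ga) Gg).
have Gbk := GGSM Gb Gk; have gE := kernel_partE g; split=> //.
  have := congr1 rexp gE.
  rewrite (rexpM _ Gbk) (rexpM _ Gk) rexp_aX rexp_bX.
  by rewrite Z4_natrE add0r -[LHS]addr0 => /addrI.
have := congr1 beta gE; rewrite (betaM Ga Gbk) (betaM Gb Gk) beta_aX.
by rewrite (betaX _ GGSb) beta_b Z4_natrE add0r mulr1 -[LHS]addr0 => /addrI.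
Qed.

Lemma normal_rexp_beta (i j : 'Z_4) k : exp_kernel k ->
  [/\ G (a ^+ i * (b ^+ j * k)), rexp (a ^+ i * (b ^+ j * k)) = i
    & beta (a ^+ i * (b ^+ j * k)) = j].
Proof.
move=> [Gk k0 bk0]; have Gb : G (b ^+ j) by apply: GGSbX.
have Ga : G (a ^+ i) by apply: GGSaX.
have Gbk := GGSM Gb Gk.
split; first exact: GGSM.
  by rewrite (rexpM _ Gbk) (rexpM _ Gk) rexp_aX rexp_bX k0 !addr0 Z4_natrE.
by rewrite (betaM Ga Gbk) (betaM Gb Gk) beta_aX (betaX _ GGSb) beta_b bk0
  add0r addr0 mulr1 Z4_natrE.
Qed.

Lemma kernel_part_normal (i j : 'Z_4) k :
  exp_kernel k -> kernel_part (a ^+ i * (b ^+ j * k)) = k.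
Proof.
by move=> /(normal_rexp_beta i j) [_ ri bj]; rewrite /kernel_part ri bj !mulKg.
Qed.

Lemma res_kernel_part n f g : rexp f = rexp g -> beta f = beta g ->
  res n f = res n g <-> res n (kernel_part f) = res n (kernel_part g).
Proof.
rewrite /kernel_part => <- <-; rewrite !resM; split=> [->//|].
by move=> /mulgI/mulgI.
Qed.

(** From the second level on, both exponents are visible in the congruence
    quotient. *)
Lemma card_level_image_kernel n :
  #|level_image n.+2 G| = (16 * #|level_image n.+2 exp_kernel|)%N.
Proof.
pose F f := (rexp f, beta f, res n.+2 (kernel_part f)).
pose B := [predX (predT : pred ('Z_4 * 'Z_4)) & level_image n.+2 exp_kernel].
rewrite (@card_level_image _ _ _ F B).
- by rewrite cardX card_prod !card_Z4.
- move=> f g Gf Gg; split=> [fg|[fg fgb fgk]].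
    have [fg_rexp fg_beta] := (res_rexp fg, res_beta fg).
    by rewrite /F fg_rexp fg_beta ((res_kernel_part _ fg_rexp fg_beta).1 fg).
  exact/(res_kernel_part _ fg fgb).
- move=> [[i j] p]; rewrite inE /=; split=> [/level_imageP [k Kk <-]|].
    have [Gg gi gj] := normal_rexp_beta i j Kk.
    exists (a ^+ i * (b ^+ j * k)) => //.
    by rewrite /F gi gj kernel_part_normal.
  by move=> [g Gg [_ _ <-]]; apply/mem_level_image/exp_kernel_part.
Qed.

(** An element of G is given by its first-level exponent, by the values of
    beta on its sections, which determine the values of rexp by balance, and
    by the kernel parts of the sections; all these are independent. *)
Lemma card_level_imageS n :
  #|level_image n.+3 G| = (4 * (4 * #|level_image n.+2 exp_kernel|) ^ 4)%N.
Proof.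
pose F f := (rexp f,
  [ffun x => (beta (sec f x), res n.+2 (kernel_part (sec f x)))]).
pose D := [predX (predT : pred 'Z_4) & level_image n.+2 exp_kernel].
pose B := [predX (predT : pred 'Z_4) & @ffun_on 'Z_4 D].
rewrite (@card_level_image _ _ _ F B).
- by rewrite cardX card_ffun_on cardX !card_Z4.
- move=> f g Gf Gg; rewrite (propext (res_succ_GGS n.+2 Gf Gg)).
  split=> [[fg fg_sec]|[fg /ffunP fg_sec]].
    rewrite /F fg; congr pair; apply/ffunP => x; rewrite !ffunE.
    rewrite (res_beta (fg_sec x)); congr pair; apply: (res_kernel_part _ _ _).1.
    + exact: res_rexp (fg_sec x).
    + exact: res_beta (fg_sec x).
    + exact: fg_sec.
  split=> // x; have := fg_sec x; rewrite !ffunE => -[fg_beta fg_k].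
  apply/res_kernel_part => //; rewrite (GGS_balanced Gf) (GGS_balanced Gg).
  congr (circ _ _); apply/funext => y.
  by have := fg_sec y; rewrite !ffunE => -[].
- move=> [i t]; rewrite inE /=; split; last first.
    move=> [f Gf [_ <-]]; apply/ffun_onP => x; rewrite ffunE /D inE /=.
    by apply: mem_level_image; apply: exp_kernel_part; apply: GGS_sec.
  move=> /ffun_onP tD.
  have /choice [k kP] x : exists k, exp_kernel k /\ res n.+2 k = (t x).2.
    have := tD x; rewrite /D; case: (t x) => j p.
    by rewrite inE => /level_imageP [k Kk kp]; exists k.
  pose al := circ (fun y => (t y).1).
  pose p x := a ^+ al x * (b ^+ (t x).1 * k x).
  have pP x : [/\ G (p x), rexp (p x) = al x & beta (p x) = (t x).1].
    exact: normal_rexp_beta (kP x).1.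
  pose h := assemble 1 p.
  have h1 : sigma h = 1 by exact: sigma_assemble.
  have hp x : sec h x = p x by exact: sec_assemble.
  have Gh : G h.
    apply: GGS_from_sections => // [x|x]; rewrite !hp; first by have [] := pP x.
    have [_ -> _] := pP x; congr (circ _ _); apply/funext => y; rewrite hp.
    by have [_ _ ->] := pP y.
  exists (h * a ^+ i); first by apply: GGSM Gh _; apply: GGSaX.
  congr pair; first exact: rexp_mul_aX.
  apply/ffunP => x; rewrite ffunE secM sec_aX mulg1 hp.
  have [_ _ ->] := pP x; have [Kk kt] := kP x.
  by rewrite kernel_part_normal // kt; case: (t x).
Qed.

Lemma card_level_image_GGS n : #|level_image n.+2 G| =
  (4 ^ ((if odd_exponent_sum e then 4 else 3) * 4 ^ n + 1))%N.
Proof.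
elim: n => [|n IH].
  rewrite odd_sumE; case: ifP => [U|/negbT U].
    exact: card_level_image2_odd.
  exact: card_level_image2_even.
rewrite card_level_imageS; move: IH; rewrite card_level_image_kernel.
move: #|_| (if _ then _ else _) => k q.
rewrite addn1 expnS (_ : 16 = 4 * 4)%N // -mulnA => /eqP.
rewrite eqn_pmul2l // => /eqP ->.
by rewrite -expnM -expnS addn1 [(4 ^ n.+1)%N]expnSr mulnA.
Qed.

End GGS.

(** * Logarithms and the lower limit *)

Local Open Scope classical_set_scope.
Local Open Scope ring_scope.

Lemma log4X (R : realType) k : log4 (4 ^ k)%N%:R = k%:R :> R.
Proof.
have ln4 : ln 4 != 0 :> R by rewrite gt_eqF // ln_gt0 // (ltr_nat _ 1 4).
by rewrite /log4 natrX lnXn ?ltr0n // -[ln _ *+ k]mulr_natl mulfK.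
Qed.

Lemma log4_ratio_cvg (R : realType) (q : nat) (w : nat -> nat) :
  (forall n, (3 * w n).+1 = 4 ^ n)%N ->
  (fun n => (q * 4 ^ n + 1)%N%:R / (w n.+2)%:R) @ \oo --> (q%:R * 3 / 16 : R).
Proof.
move=> w3; pose z n : R := 4^-1 ^+ n.
have z0 : z @ \oo --> (0 : R).
  apply: cvg_expr; rewrite ger0_norm ?invr_ge0 // invf_lt1 //.
  by rewrite (ltr_nat _ 1 4).
have -> : (fun n => (q * 4 ^ n + 1)%N%:R / (w n.+2)%:R) =
          (fun n => (q%:R + z n) * 3 / (16 - z n)) :> (nat -> R).
  apply/funext => n; have /(congr1 (fun m => m%:R : R)) := w3 n.+2.
  rewrite -natr1 natrM 2!expnS mulnA natrM natrX => wE.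
  have p0 : 4 ^+ n != 0 :> R by rewrite expf_neq0 ?pnatr_eq0.
  have W0 : (w n.+2)%:R != 0 :> R.
    rewrite pnatr_eq0; apply/eqP => w0; have /(congr1 odd) := w3 n.+2.
    by rewrite w0 muln0 expnS oddM.
  rewrite natrD natrM natrX /z exprVn.
  have -> : 16 - (4 ^+ n)^-1 = 3 * (w n.+2)%:R / 4 ^+ n :> R.
    rewrite (_ : 3 * _ = 16 * 4 ^+ n - 1) ?mulrBl ?mulfK ?mul1r //.
    by rewrite -[LHS](addrK 1) wE.
  by field; rewrite W0 p0.
suff : (fun n => (q%:R + z n) * 3 / (16 - z n)) @ \oo -->
       ((q%:R + 0) * 3 / (16 - 0) : R) by rewrite addr0 subr0.
apply: cvgM; first by apply: cvgMl; apply: cvgD => //; exact: cvg_cst.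
apply: cvgV; first by rewrite subr0 pnatr_eq0.
by apply: cvgB => //; exact: cvg_cst.
Qed.

Theorem theorem4p1 (R : realType) (e : 'rV['Z_4]_3)
    (he : ~ invertible_symmetric e) :
  hdim_W4 R (closure (GGS e)) =
    (if odd_exponent_sum e then 3 / 4 else 9 / 16)%:E /\
  (if odd_exponent_sum e then
     forall n : nat, (2 <= n)%N ->
       log4 (congruence_quotient_order (GGS e) n)%:R
       = (4 ^ (n - 1) + 1)%N%:R :> R
   else
     forall n : nat, (2 <= n)%N ->
       log4 (congruence_quotient_order (GGS e) n)%:R
       = (3 * 4 ^ (n - 2) + 1)%N%:R :> R).
Proof.
have GGS_group := GGS_subgroup e.
pose q := if odd_exponent_sum e then 4%N else 3%N.
have log_order n : log4 (congruence_quotient_order (GGS e) n.+2)%:R =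
    (q * 4 ^ n + 1)%N%:R :> R.
  by rewrite order_level_image // card_level_image_GGS // log4X.
split; last first.
  case: ifP => sum_e [|[|n]] // _; rewrite log_order /q sum_e ?subSS ?subn0 //.
  by rewrite expnS.
have -> : (if odd_exponent_sum e then 3 / 4 else 9 / 16) = q%:R * 3 / 16 :> R.
  by rewrite /q; case: ifP => _; apply/eqP;
    rewrite ?eqr_div ?pnatr_eq0 // -?natrM.
rewrite /hdim_W4; apply: (cvg_limn_einf_sup _).1.
have [w wE w3] : exists2 w,
    forall n, congruence_quotient_order W4 n = (4 ^ w n)%N
    & forall n, ((3 * w n).+1 = 4 ^ n)%N.
  have /choice [w wP] n : exists w,
      congruence_quotient_order W4 n = (4 ^ w)%N /\ ((3 * w).+1 = 4 ^ n)%N.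
    rewrite (order_level_image _ W4_subgroup).
    by have [w] := card_level_image_W4 n; exists w.
  by exists w => n; have [] := wP n.
rewrite -(cvg_shiftn 2); apply: cvg_EFin; first exact: nearW.
rewrite (_ : _ \o _ = fun n => (q * 4 ^ n + 1)%N%:R / (w n.+2)%:R).
  exact: log4_ratio_cvg.
apply/funext => n; rewrite /= addn2 order_level_image.
  by rewrite level_image_closure -order_level_image // log_order wE log4X.
exact: closure_subgroup.
Qed.
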